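(* Let $G$ be a $2$-connected outerplanar graph with a fixed outerplane drawing, let $M,N$ be perfect matchings of $G$, and let $I=(G,M,N)$. If $E_{\rm in}\cap M\cap N=\emptyset$, then $\mathrm{OPT}(I)=\mathrm{gap}(M,N)/2$.
   Context: Graphs are undirected, may have parallel edges, no loops. For a matching $M$, a cycle $C$ (identified with its edge set) is $M$-alternating if its edges alternate between $M$ and $E(G)\setminus M$. A reconfiguration sequence between perfect matchings $M,N$ is a sequence $\langle M_0,\dots,M_t\rangle$ of perfect matchings with $M_0=M$, $M_t=N$, and $M_i=M_{i-1}\triangle C_i$ for some $M_{i-1}$-alternating cycle $C_i$ ($i=1,\dots,t$); its length is $t$, and $\mathrm{OPT}(I)$ is the minimum length of such a sequence. Fix an outerplane drawing of $G$; the outer face boundary $C_{\rm out}$ is a simple cycle and $E_{\rm in}=E(G)\setminus C_{\rm out}$. Let $V^*$ be the set of bounded faces, $E_{v^*}$ the boundary edges of face $v^*$, $U^*=\{v^*\in V^*: E_{v^*}\cap C_{\rm out}\neq\emptyset\}$, and $\tilde U^*=\{\tilde u^*:u^*\in U^*\}$ a disjoint copy. The tree $G^*$ has vertex set $V^*\cup\tilde U^*$ and edges $E^*_{\rm in}=\{v^*w^*: v^*,w^*\in V^*, |E_{v^*}\cap E_{w^*}|=1\}$ (each corresponding to the shared chord $e\in E_{\rm in}$) and $\tilde E^*=\{u^*\tilde u^*:u^*\in U^*\}$. Each $u^*\in U^*$ either has all edges of $E_{u^*}\cap C_{\rm out}$ in $M\triangle N$ ($u^*\in U^*_1$) or none of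 them ($u^*\in U^*_2$). Lengths: $\ell(e^* )=|M\cap\{e\}|+|N\cap\{e\}|$ for $e^*\in E^*_{\rm in}$ corresponding to chord $e$; $\ell(u^*\tilde u^* )=1$ if $u^*\in U^*_1$ and $0$ if $u^*\in U^*_2$. $\mathrm{gap}(M,N)$ is the maximum, over pairs of vertices of $G^*$, of the $\ell$-length of the path between them in $G^*$.
   Formalization: The case where G is a single cycle (E_in empty) and M ≠ N is excluded: there G* is one edge of length 1, so gap(M,N) = 1 while OPT(I) = 1, and the claimed equality OPT = gap/2 fails. Cycles with M = N are kept. *)

(* Defs.v *)
From HB Require Import structures.
From mathcomp Require Import all_boot all_fingroup.

Set Implicit Arguments.
Unset Strict Implicit.
Unset Printing Implicit Defensive.

(* Finite loopless multigraphs. The two ends of an edge are indexed by bool;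
   which end is false and which is true carries no meaning. *)
Record mgraph := MGraph {
  vert : finType;
  edge : finType;
  endpt : edge -> bool -> vert;
  no_loop : forall e, endpt e false != endpt e true
}.

Section Graph.
Variable G : mgraph.
Implicit Types (M N C : {set edge G}) (x y v : vert G).

Definition incident (e : edge G) v : bool :=
  (endpt e false == v) || (endpt e true == v).

(* A dart (e, b) is the edge e traversed from its end b to its end ~~ b. *)
Definition dart : finType := (edge G * bool)%type.
Definition dedge (d : dart) : edge G := d.1.
Definition drev (d : dart) : dart := (d.1, ~~ d.2).
Definition dtail (d : dart) : vert G := endpt d.1 d.2.
Definition dhead (d : dart) : vert G := dtail (drev d).

Lemma drev_inj : injective drev.
Proof. by move=> [e b] [e' b'] [-> /negb_inj->]. Qed.

Definition adj x y : bool :=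
  (x != y) && [exists e, incident e x && incident e y].

Definition connected : Prop := forall x y, connect adj x y.

Definition connected_without v : Prop :=
  forall x y, x != v -> y != v ->
    connect [rel a b | [&& a != v, b != v & adj a b]] x y.

(* For at least three vertices this is the usual notion, the bound on the
   number of edges being then automatic. On two vertices the single edge is
   excluded, but a bundle of at least two parallel edges is allowed. *)
Definition two_connected : Prop :=
  [/\ 1 < #|vert G|, 1 < #|edge G|, connected & forall v, connected_without v].

Definition perfect_matching M : Prop :=
  forall v, #|[set e in M | incident e v]| = 1.

Definition symdiff M N : {set edge G} := (M :\: N) :|: (N :\: M).

(* A cyclic sequence of darts tracing a cycle. Two distinct parallel edges form
   a cycle; distinctness of the edges rules out going back and forth along a
   single edge. *)
Definition cycle_darts (c : seq dart) : bool :=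
  [&& c != [::], path.cycle (fun d d' => dhead d == dtail d') c,
      uniq (map dtail c) & uniq (map dedge c)].

Definition alternating_darts M (c : seq dart) : bool :=
  path.cycle (fun d d' => (dedge d \in M) != (dedge d' \in M)) c.

Definition alternating_cycle M C : Prop :=
  exists c : seq dart,
    [/\ cycle_darts c, alternating_darts M c & C = [set e in map dedge c]].

(* The sequence is Ms 0, ..., Ms t. *)
Definition reconf_seq M N (t : nat) (Ms : nat -> {set edge G}) : Prop :=
  [/\ Ms 0 = M, Ms t = N, forall i, i <= t -> perfect_matching (Ms i)
    & forall i, i < t -> exists2 C, alternating_cycle (Ms i) C
                                  & Ms i.+1 = symdiff (Ms i) C].

Definition is_OPT M N (t : nat) : Prop :=
  (exists Ms, reconf_seq M N t Ms) /\
  (forall t' Ms, reconf_seq M N t' Ms -> t <= t').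

(* When the orbits of r list the darts out of each vertex in cyclic order, the
   orbits of face_perm r trace the face boundaries. *)
Definition face_perm (r : {perm dart}) : {perm dart} := (perm drev_inj * r)%g.

(* An outerplane drawing, up to homeomorphism, as a rotation system with a
   distinguished face. For connected G (with an edge), Euler's formula says
   that the surface carrying the rotation system is the sphere. *)
Record outerplane_drawing := OuterplaneDrawing {
  rotation : {perm dart};
  outer : {set dart};
  rotation_vertex : forall d d',
    (d' \in porbit rotation d) = (dtail d' == dtail d);
  euler : #|vert G| + #|porbits (face_perm rotation)| = #|edge G| + 2;
  outer_face : outer \in porbits (face_perm rotation);
  outer_vertex : forall v, exists2 d, d \in outer & dtail d = v
}.

Variable D : outerplane_drawing.

Definition boundary (f : {set dart}) : {set edge G} := [set dedge d | d in f].

Definition Cout : {set edge G} := boundary (outer D).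
Definition Ein : {set edge G} := ~: Cout.

Definition bface : finType :=
  {f : {set dart} | (f \in porbits (face_perm (rotation D))) && (f != outer D)}.

Definition Ef (v : bface) : {set edge G} := boundary (val v).

Definition uface : finType := {u : bface | Ef u :&: Cout != set0}.

(* inl v is the bounded face v; inr u is the copy of the face val u. *)
Definition gstar : finType := (bface + uface)%type.

Definition gstar_adj (x y : gstar) : bool :=
  match x, y with
  | inl v, inl w => (v != w) && (#|Ef v :&: Ef w| == 1)
  | inl v, inr u | inr u, inl v => val u == v
  | inr _, inr _ => false
  end.

Definition in_U1 M N (u : uface) : bool :=
  Ef (val u) :&: Cout \subset symdiff M N.

(* Only meaningful on adjacent x and y; in the first case the sum has then a
   single term, given by the shared chord. *)
Definition ell M N (x y : gstar) : nat :=
  match x, y with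
  | inl v, inl w => \sum_(e in Ef v :&: Ef w) ((e \in M) + (e \in N))
  | inl _, inr u | inr u, inl _ => in_U1 M N u
  | inr _, inr _ => 0
  end.

Definition gstar_path (x y : gstar) (p : seq gstar) : bool :=
  [&& path gstar_adj x p, uniq (x :: p) & last x p == y].

Definition path_length M N (x : gstar) (p : seq gstar) : nat :=
  sumn (pairmap (ell M N) x p).

(* For 2-connected G, gstar_adj is a tree, so that p ranges over a single path;
   the bound on the size of p is no restriction on simple paths. *)
Definition gstar_dist M N (x y : gstar) : nat :=
  \max_(p : #|gstar|.-bseq gstar | gstar_path x y p) path_length M N x p.

Definition gap M N : nat := \max_x \max_y gstar_dist M N x y.

End Graph.

(* Main.v *)
(* Over the field with two elements, Euler's formula says that the boundaries of
   the sets of faces are exactly the edge sets of even degree, and dually that an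
   edge set meeting each face boundary evenly is a cut. The second fact and
   2-connectivity show that the outer face visits each vertex once; counting then
   shows that the bounded faces form a tree under adjacency through chords, and
   that the simple cycles are the boundaries of its connected sets of faces.

   Write M (+) N as the boundary of a set S of bounded faces. As no chord lies in
   both M and N, the length of an edge of G* tells whether S changes along it (the
   copies of the faces in U* being outside S). Reversing a cycle replaces S by its
   symmetric difference with a connected set F, which a simple path of G* enters
   and leaves at most once, so that the number of changes along the path drops by
   at most 2 and OPT is at least gap / 2.

   For the converse, the midpoint of a longest path between leaves is a face c
   that is at distance at most k = gap / 2 from every face. Let F consist of the
   faces at distance less than k that can be reached from c without crossing a
   chord of M. The boundary of F is an M-alternating cycle, and reversing it brings
   all faces within distance k - 1 of c. The new matching may share chords with N,
   but only at distance exactly k - 1 from c, and this weaker condition is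
   preserved. *)
Require Import Defs.
From mathcomp Require Import all_boot all_fingroup all_algebra.
From mathcomp Require Import zify.

Set Implicit Arguments.
Unset Strict Implicit.
Unset Printing Implicit Defensive.

(** * Duality of the incidence spaces *)

Section Duality.
Import GRing.Theory.
Local Open Scope ring_scope.

(** The left kernel lies on the line of constant vectors, so its dimension is at most one. *)
Lemma corank_le1 (K : fieldType) n m (A : 'M[K]_(n, m)) :
  (forall v : 'rV_n, v *m A = 0 -> forall i j, v 0 i = v 0 j) ->
  (n <= \rank A + 1)%N.
Proof.
case: n A => [|n] A cst; first by [].
have ker1 : (kermx A <= (const_mx 1 : 'rV_n.+1))%MS.
  apply/row_subP=> i.
  have: row i (kermx A) *m A = 0 by apply/sub_kermxP; exact: row_sub.
  move: (row i _) => v vA0; suff -> : v = v 0 0 *: const_mx 1 by exact: scalemx_sub.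
  by apply/rowP=> j; rewrite !mxE mulr1; exact: cst.
have := leq_trans (mxrankS ker1) (rank_leq_row _).
by rewrite mxrank_ker leq_subLR addnC.
Qed.

(** Orthogonality puts the row space of [B] inside the kernel of the transpose of [A]. That kernel
    has dimension at most m - n + 1 = p - 1, which is at most the rank of [B], so the two spaces
    agree. *)
Lemma row_space_dual (K : fieldType) n p m (A : 'M[K]_(n, m)) (B : 'M_(p, m)) :
  A *m B^T = 0 -> (n + p = m + 2)%N ->
  (forall v : 'rV_n, v *m A = 0 -> forall i j, v 0 i = v 0 j) ->
  (forall v : 'rV_p, v *m B = 0 -> forall i j, v 0 i = v 0 j) ->
  forall z : 'rV_m, z *m A^T = 0 -> exists s, z = s *m B.
Proof.
move=> AB0 nm /corank_le1 rA /corank_le1 rB z /sub_kermxP zA.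
have sBK : (B <= kermx A^T)%MS.
  by apply/sub_kermxP; rewrite -[LHS]trmxK trmx_mul trmxK AB0 trmx0.
apply/submxP; apply: submx_trans zA _.
rewrite -(geq_leqif (mxrank_leqif_sup sBK)) mxrank_ker mxrank_tr.
by lia.
Qed.

(** The duality over [bool], the field with addition [addb] and product [andb]. It is applied twice,
    the second time with vertices and faces exchanged. *)
Lemma incidence_dual (V F E : finType) (a : V -> E -> bool) (b : F -> E -> bool) :
  (forall v f, \big[addb/false]_e (a v e && b f e) = false) ->
  (#|V| + #|F| = #|E| + 2)%N ->
  (forall s : V -> bool,
    (forall e, \big[addb/false]_v (s v && a v e) = false) ->
    forall v w, s v = s w) ->
  (forall s : F -> bool,
    (forall e, \big[addb/false]_f (s f && b f e) = false) ->
    forall f g, s f = s g) ->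
  forall z : E -> bool,
    (forall v, \big[addb/false]_e (a v e && z e) = false) ->
  exists s : F -> bool, forall e, z e = \big[addb/false]_f (s f && b f e).
Proof.
move=> ab0 card_VFE a_cst b_cst z az0.
pose mx (I : finType) (c : I -> E -> bool) : 'M[bool]_(#|I|, #|E|) :=
  \matrix_(i, j) c (enum_val i) (enum_val j).
pose rv (I : finType) (c : I -> bool) : 'rV[bool]_#|I| := \row_i c (enum_val i).
have sumE (I : finType) (c : I -> bool) :
    \big[addb/false]_i c i = \sum_(i < #|I|) c (enum_val i).
  rewrite (reindex (@enum_val I I)) //=.
  by apply: onW_bij; exact: enum_val_bij.
have cst (I : finType) (c : I -> E -> bool) :
    (forall s : I -> bool,
      (forall e, \big[addb/false]_i (s i && c i e) = false) ->
      forall i j, s i = s j) ->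
    forall v : 'rV_#|I|, v *m mx I c = 0 -> forall i j, v 0 i = v 0 j.
  move=> ccst v vc0 i j.
  rewrite -(enum_valK i) -(enum_valK j).
  apply: (ccst (fun x => v 0 (enum_rank x))) => e; rewrite sumE.
  have /rowP/(_ (enum_rank e)) := vc0; rewrite !mxE => vc0e.
  rewrite -[RHS]vc0e; by apply: eq_bigr => k _; rewrite !mxE enum_valK enum_rankK.
have AB0 : mx V a *m (mx F b)^T = 0.
  apply/matrixP=> i j; rewrite !mxE -[RHS](ab0 (enum_val i) (enum_val j)) sumE.
  by apply: eq_bigr => k _; rewrite !mxE.
have zA0 : rv E z *m (mx V a)^T = 0.
  apply/rowP=> i; rewrite !mxE -[RHS](az0 (enum_val i)) sumE.
  by apply: eq_bigr => k _; rewrite !mxE mulrC.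
have [s zs] := row_space_dual AB0 card_VFE (cst V a a_cst) (cst F b b_cst) zA0.
exists (fun f => s 0 (enum_rank f)) => e; rewrite sumE.
have /rowP/(_ (enum_rank e)) := zs; rewrite !mxE enum_rankK => ->.
by apply: eq_bigr => k _; rewrite !mxE enum_valK enum_rankK.
Qed.

End Duality.

(** * Rooted trees *)

Section Changes.
Variables (T : eqType) (s : T -> bool).
Implicit Types (x y : T) (p : seq T).

(** When [s] marks the faces enclosed by M (+) N, this becomes the length of a path in G*. *)
Definition changes x p := sumn (pairmap (fun a b => s a (+) s b : nat) x p).

Lemma changes_cons x y p : changes x (y :: p) = (s x (+) s y) + changes y p.
Proof. by []. Qed.

Lemma odd_changes x p : odd (changes x p) = s x (+) s (last x p).
Proof.
elim: p x => [|y p IH] x; first by rewrite /= addbb.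
by rewrite changes_cons oddD oddb IH addbA addbK.
Qed.

Lemma changes_cat x p q :
  changes x (p ++ q) = changes x p + changes (last x p) q.
Proof. by rewrite /changes pairmap_cat sumn_cat. Qed.

(** Each step adds at most one change, so no intermediate value is skipped. *)
Lemma changes_split x p k : k <= changes x p ->
  exists p1 p2, p = p1 ++ p2 /\ changes x p1 = k.
Proof.
elim/last_ind: p => [|p y IH]; first by rewrite leqn0 => /eqP->; exists [::], [::].
rewrite leq_eqVlt => /orP[/eqP->|]; first by exists (rcons p y), [::]; rewrite cats0.
rewrite -cats1 changes_cat changes_cons addn0 => kp.
have /IH[p1 [p2 [-> <-]]] : k <= changes x p by move: kp; case: (_ (+) _); lia.
by exists p1, (p2 ++ [:: y]); rewrite catA.
Qed.

End Changes.

Section RootedTree.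
Variables (T : eqType) (root : T) (up : T -> T) (h : T -> nat).
Hypothesis h_root : h root = 0.
Hypothesis h_up : forall x, x != root -> h x = (h (up x)).+1.

(** A tree is encoded by a parent map and a depth; the value of [up] at the root is a dummy. *)
Definition chain x := traject up x (h x).+1.
Definition anc w x := w \in chain x.
Definition tree_adj x y := (x != root) && (up x == y) || (y != root) && (up y == x).

Lemma tree_ind (P : T -> Prop) :
  P root -> (forall x, x != root -> P (up x) -> P x) -> forall x, P x.
Proof.
move=> Proot Pup x; move hx: (h x) => n.
elim: n x hx => [|n IHn] x; have [-> //|xr] := eqVneq x root.
  by rewrite h_up.
by rewrite h_up // => -[/IHn]; exact: Pup.
Qed.

Lemma chain_root : chain root = [:: root].
Proof. by rewrite /chain h_root. Qed.

Lemma chain_up x : x != root -> chain x = x :: chain (up x).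
Proof. by move=> /h_up hx; rewrite /chain hx. Qed.

Lemma anc_root w : anc w root = (w == root).
Proof. by rewrite /anc chain_root inE. Qed.

Lemma anc_up w x : x != root -> anc w x = (w == x) || anc w (up x).
Proof. by move=> xr; rewrite /anc chain_up // inE. Qed.

Lemma anc_refl x : anc x x.
Proof. by rewrite /anc /chain /= inE eqxx. Qed.

Lemma anc_h w x : anc w x -> w != x -> h w < h x.
Proof.
elim/tree_ind: x => [|x xr IH]; first by rewrite anc_root => ->.
rewrite anc_up // => /orP[->//|wx _]; rewrite (h_up xr) ltnS.
by have [->//|/(IH wx)/ltnW] := eqVneq w (up x).
Qed.

Lemma anc_up_nanc x : x != root -> anc x (up x) = false.
Proof.
move=> xr; apply/negP=> /[dup] /anc_h; have [e _|_ /(_ isT)] := eqVneq x (up x).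
  by have := h_up xr; rewrite -e => /n_Sn.
by rewrite (h_up xr) => /ltnW; rewrite ltnn.
Qed.

Lemma anc_total a b x : anc a x -> anc b x -> anc a b || anc b a.
Proof.
elim/tree_ind: x => [|x xr IH].
  by rewrite !anc_root => /eqP-> /eqP->; rewrite anc_refl.
rewrite (anc_up a xr) (anc_up b xr).
case/orP=> [/eqP->|ax] /orP[/eqP->|bx]; rewrite ?anc_refl ?IH //.
  by rewrite (anc_up b xr) bx !orbT.
by rewrite (anc_up a xr) ax orbT.
Qed.

Lemma anc_trans b a x : anc a b -> anc b x -> anc a x.
Proof.
move=> ab; elim/tree_ind: x => [|x xr IH]; first by rewrite anc_root => /eqP<-.
by rewrite (anc_up b xr) => /orP[/eqP<-//|/IH ax]; rewrite (anc_up a xr) ax orbT.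
Qed.

Section Dist.
Variable s : T -> bool.

(** The changes of [s] on the path from [x] to the root. The list has [h x] terms and so stops just
    below the root. *)
Definition dist x := sumn [seq s y (+) s (up y) : nat | y <- traject up x (h x)].

Lemma dist_root : dist root = 0.
Proof. by rewrite /dist h_root. Qed.

Lemma dist_up x : x != root -> dist x = (s x (+) s (up x)) + dist (up x).
Proof. by move=> /h_up hx; rewrite /dist hx. Qed.

Lemma odd_dist x : odd (dist x) = s x (+) s root.
Proof.
elim/tree_ind: x => [|x xr IH]; first by rewrite dist_root addbb.
by rewrite dist_up // oddD IH oddb addbA addbK.
Qed.

Lemma dist_anc w x : anc w x -> dist w <= dist x.
Proof.
elim/tree_ind: x => [|x xr IH]; first by rewrite anc_root => /eqP->.
by rewrite anc_up // => /orP[/eqP->//|/IH/leq_trans->//]; rewrite (dist_up xr) leq_addl.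
Qed.

(** After a step down, the parent of the current vertex is the vertex just left, so a simple path
    can never turn upwards again. *)
Lemma path_descends x p : x != root -> path tree_adj x p ->
  uniq (x :: p) -> up x \notin p ->
  anc x (last x p) /\ changes s x p + dist x = dist (last x p).
Proof.
elim: p x => [|y p IH] x xr /=; first by rewrite anc_refl.
rewrite !inE !negb_or => /andP[/orP[/andP[_ /eqP->]|/andP[yr /eqP yx]] yp];
  first by rewrite eqxx.
move=> /andP[/andP[xy xp] /andP[ynp up_]] /andP[_ uxp].
have [||anc_y dy] := IH y yr yp; rewrite ?yx //= ?ynp //.
split; first by apply: anc_trans anc_y; rewrite anc_up // yx anc_refl orbT.
by rewrite -dy (dist_up yr) yx changes_cons addbC; lia.
Qed.

(** The subtree under [w] can be entered only through [w]. *)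
Lemma path_enters w x p : path tree_adj x p -> w \notin x :: p ->
  anc w (last x p) -> anc w x.
Proof.
elim: p x => //= y p IH x /andP[xy yp]; rewrite inE negb_or => /andP[wx wp] wl.
have wy := IH y yp wp wl.
case/orP: xy => /andP[xr /eqP e]; first by rewrite anc_up // e wy orbT.
by move: wy wp; rewrite anc_up // e inE => /orP[->|].
Qed.

(** A simple path climbs to the lowest common ancestor [z] of its ends and then descends. *)
Lemma path_apex x p : path tree_adj x p -> uniq (x :: p) ->
  exists z, [/\ anc z x, anc z (last x p),
    changes s x p + 2 * dist z = dist x + dist (last x p)
    & forall w, anc w x -> anc w (last x p) -> dist w <= dist z].
Proof.
elim: p x => [|y p IH] x /=.
  by move=> _ _; exists x; rewrite anc_refl /changes /=; split=> // [|w /dist_anc//]; lia.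
move=> /andP[xy yp] /andP[xnp uyp].
case/orP: xy => /andP[xr /eqP e].
  have [z [zy zl ch zmax]] := IH y yp uyp.
  exists z; split=> //; first by rewrite anc_up // e zy orbT.
    by rewrite (dist_up xr) e changes_cons; lia.
  move=> w; rewrite anc_up // e => /orP[/eqP->|]; last exact: zmax.
  move=> /(path_enters yp xnp); by rewrite -e anc_up_nanc.
have [|yl ch] := path_descends xr yp uyp.
  by rewrite e; move: xnp; rewrite inE negb_or => /andP[].
exists x; split=> //.
- exact: anc_refl.
- by apply: anc_trans yl; rewrite anc_up // e anc_refl orbT.
- by rewrite -ch (dist_up xr) e changes_cons addbC; lia.
- by move=> w /dist_anc.
Qed.

End Dist.

Definition all_up (good : pred T) x := all good (chain x).

Lemma all_up_root good : all_up good root = good root.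
Proof. by rewrite /all_up chain_root /= andbT. Qed.

Lemma all_up_up good x : x != root -> all_up good x = good x && all_up good (up x).
Proof. by move=> xr; rewrite /all_up chain_up. Qed.

End RootedTree.

(** * Darts, even edge sets and cuts *)

Section AddbSums.

Lemma addb_false_eq a b : a (+) b = false -> a = b.
Proof. by case: a; case: b. Qed.

Lemma big_addb1 (I : finType) (P : pred I) (F : I -> bool) a : P a ->
  (forall i, P i -> i != a -> F i = false) ->
  \big[addb/false]_(i | P i) F i = F a.
Proof.
move=> Pa F0; rewrite (bigD1 a) //= big1 ?addbF // => i /andP[]; exact: F0.
Qed.

Lemma big_addb2 (I : finType) (P : pred I) (F : I -> bool) a b :
  P a -> P b -> a != b ->
  (forall i, P i -> i != a -> i != b -> F i = false) ->
  \big[addb/false]_(i | P i) F i = F a (+) F b.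
Proof.
move=> Pa Pb ab F0; rewrite (bigD1 a) //=; congr (_ (+) _).
by apply: big_addb1 => [|i /andP[Pi ia] ib]; [rewrite Pb eq_sym | exact: F0].
Qed.

Lemma big_addb_delta (I : finType) (F : I -> bool) a :
  \big[addb/false]_i (F i && (a == i)) = F a.
Proof.
rewrite (@big_addb1 _ predT _ a) // ?eqxx ?andbT // => i _.
by rewrite eq_sym => /negPf->; rewrite andbF.
Qed.

End AddbSums.

Section Darts.
Variable G : mgraph.
Implicit Types (d : dart G) (e : edge G) (v x y : vert G).

Lemma drevK : involutive (@drev G).
Proof. by case=> e b; rewrite /drev /= negbK. Qed.

Lemma drev_neq d : drev d != d.
Proof. by case: d => e []; rewrite xpair_eqE andbF. Qed.

Lemma dtail_dhead d : dtail d != dhead d.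
Proof.
by case: d => e []; rewrite /dhead /dtail /= ?no_loop // eq_sym no_loop.
Qed.

Lemma dhead_drev d : dhead (drev d) = dtail d.
Proof. by rewrite /dhead drevK. Qed.

Lemma same_edge d d' : d.1 = d'.1 -> d = d' \/ d = drev d'.
Proof. by case: d d' => [e []] [e' []] /= ->; [left|right|right|left]. Qed.

Lemma incident_dart e v : incident e v -> exists2 d, d.1 = e & dtail d = v.
Proof. by case/orP=> /eqP <-; [exists (e, false)|exists (e, true)]. Qed.

Lemma incident_dtail d : incident d.1 (dtail d).
Proof. by case: d => e []; rewrite /incident /dtail /= eqxx ?orbT. Qed.

Lemma incidentE d v : incident d.1 v = (dtail d == v) || (dhead d == v).
Proof. by case: d => e []; rewrite /incident /dhead /dtail //= orbC. Qed.

Lemma adj_dart x y : adj x y -> exists2 d, dtail d = x & dhead d = y.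
Proof.
case/andP=> xy /existsP[e /andP[/incident_dart[d <- dx]]].
rewrite incidentE dx (negPf xy) /= => /eqP hy; by exists d.
Qed.

Lemma sum_dart (F : dart G -> bool) :
  \big[addb/false]_d F d = \big[addb/false]_e (F (e, false) (+) F (e, true)).
Proof.
under [RHS]eq_bigr => e _.
  rewrite (_ : addb _ _ = \big[addb/false]_(b : bool) F (e, b)).
    over.
  by rewrite -(big_addb2 (P := predT) (F := fun b => F (e, b))) // => -[].
by rewrite pair_bigA /=; apply: eq_bigr => -[].
Qed.

(** Without loops, each edge at [v] has exactly one dart with tail [v], so the sum is the degree of
    [v] modulo 2. *)
Definition even_set (z : edge G -> bool) :=
  forall v, \big[addb/false]_(d | dtail d == v) z d.1 = false.

Definition cut (Y : vert G -> bool) e := Y (endpt e false) (+) Y (endpt e true).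

Lemma cutE Y d : cut Y d.1 = Y (dtail d) (+) Y (dhead d).
Proof. by case: d => e []; rewrite /cut /dhead /dtail //= addbC. Qed.

Lemma sum_star (z : edge G -> bool) v :
  \big[addb/false]_(d | dtail d == v) z d.1 =
  \big[addb/false]_e (((endpt e false == v) (+) (endpt e true == v)) && z e).
Proof.
rewrite big_mkcond sum_dart; apply: eq_bigr => e _; rewrite /dtail /=.
by do 2!case: (_ == _); case: (z e).
Qed.

End Darts.

(** * Faces *)

Section Drawing.
Variables (G : mgraph) (D : outerplane_drawing G).
Hypothesis G2 : two_connected G.
Implicit Types (d : dart G) (e : edge G) (v x y : vert G) (f g c : bface D).

Let r := rotation D.
Let phi := face_perm r.

Lemma face_permE d : phi d = r (drev d).
Proof. by rewrite permM permE. Qed.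

Definition face d := porbit (face_perm (rotation D)) d.
(* None on the outer face. *)
Definition dface d : option (bface D) := insub (face d).

Lemma face_rotation d : face (r d) = face (drev d).
Proof.
rewrite -{1}(drevK d) -face_permE; apply/eqP.
rewrite eq_porbit_mem; exact: (mem_porbit phi 1).
Qed.

Lemma face_phi d : face (phi d) = face d.
Proof. by rewrite face_permE face_rotation drevK. Qed.

Lemma porbits_face (X : {set dart G}) d :
  X \in porbits phi -> (d \in X) = (face d == X).
Proof.
case/imsetP=> d0 _ ->; rewrite -eq_porbit_mem; exact/eqP/eqP.
Qed.

Lemma outerE d : (d \in outer D) = (face d == outer D).
Proof. exact: porbits_face (outer_face D). Qed.

Lemma dface_None d : (dface d == None) = (d \in outer D).
Proof.
rewrite outerE /dface; case: insubP => [f /andP[_ fo] ff|]; first by rewrite (negPf fo).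
by rewrite negb_and negbK imset_f //= => ->.
Qed.

Lemma dface_Some d f : (dface d == Some f) = (d \in val f).
Proof.
rewrite (porbits_face _ (proj1 (andP (valP f)))) /dface.
case: insubP => [f' _ <-//|]; rewrite negb_and negbK imset_f //= => /eqP->.
by apply/esym/negbTE; rewrite eq_sym; have /andP[] := valP f.
Qed.

Lemma dfaceP d f : reflect (dface d = Some f) (d \in val f).
Proof. by rewrite -dface_Some; exact: eqP. Qed.

Lemma dface_face d d' : face d = face d' <-> dface d = dface d'.
Proof.
split; first by rewrite /dface => ->.
case fd: (dface d) => [f|] /esym/eqP; last first.
  by move/eqP: fd; rewrite !dface_None !outerE => /eqP-> /eqP->.
by move/eqP: fd; rewrite !dface_Some !porbits_face ?(proj1 (andP (valP f))) // => /eqP-> /eqP->.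
Qed.

Lemma dtail_rotation d : dtail (r d) = dtail d.
Proof. by apply/eqP; rewrite -(rotation_vertex D) (mem_porbit _ 1). Qed.

Lemma dtail_phi d : dtail (phi d) = dhead d.
Proof. by rewrite face_permE dtail_rotation. Qed.

Lemma bface_dart f : exists d, dface d = Some f.
Proof.
have /andP[/imsetP[d _ fd] _] := valP f.
by exists d; apply/dfaceP; rewrite fd porbit_id.
Qed.

Lemma vertex_cst (B : Type) (P : dart G -> B) : (forall d, P (r d) = P d) ->
  forall d d', dtail d = dtail d' -> P d = P d'.
Proof.
move=> Pr d d' dd'.
have /porbitP[n ->] : d' \in porbit r d by rewrite rotation_vertex dd'.
by elim: n => [|n IH]; rewrite ?expg0 ?perm1 // expgSr permM Pr.
Qed.

(** For connected graphs, rotation and reversal act transitively on the darts. *)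
Lemma dart_cst (B : Type) (P : dart G -> B) : (forall d, P (r d) = P d) ->
  (forall d, P (drev d) = P d) -> forall d d', P d = P d'.
Proof.
move=> Pr Prev d d'; have [_ _ conn _] := G2.
have /connectP[p] := conn (dtail d) (dtail d').
elim: p d => [|y p IH] d /=; first by move=> _ e; exact: (vertex_cst Pr).
move=> /andP[/adj_dart[d1 d1d d1y] yp] d'l.
rewrite (vertex_cst Pr (esym d1d)) -Prev.
by apply: IH; rewrite -/(dhead d1) d1y.
Qed.

Definition ftype : finType := {X : {set dart G} | X \in porbits (face_perm (rotation D))}.

Lemma face_in d : face d \in porbits (face_perm (rotation D)).
Proof. exact: imset_f. Qed.

Definition Ftype X (XP : X \in porbits (face_perm (rotation D))) : ftype := exist _ X XP.
Definition Face d := Ftype (face_in d).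

Lemma FaceE d (f : ftype) : (Face d == f) = (face d == val f).
Proof. by []. Qed.

Definition vertex_inc v e := (endpt e false == v) (+) (endpt e true == v).
(** Incidence modulo 2: an edge with [f] on both sides would count as not incident to it. *)
Definition face_inc (f : ftype) e :=
  (Face (e, false) == f) (+) (Face (e, true) == f).

Lemma sum_vertex_inc (s : vert G -> bool) e :
  \big[addb/false]_v (s v && vertex_inc v e) = cut s e.
Proof.
under eq_bigr do rewrite andb_addr.
by rewrite big_split /= !big_addb_delta.
Qed.

Lemma sum_face_inc (s : ftype -> bool) e :
  \big[addb/false]_(f : ftype) (s f && face_inc f e) = s (Face (e, false)) (+) s (Face (e, true)).
Proof.
under eq_bigr do rewrite andb_addr.
by rewrite big_split /= !big_addb_delta.
Qed.

(** The left and right faces of the darts out of [v] give two sums that cancel: the face of [drev d]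
    is that of [r d], and [r] permutes these darts. *)
Lemma incidence_orth v (f : ftype) : \big[addb/false]_e (vertex_inc v e && face_inc f e) = false.
Proof.
rewrite (_ : bigop _ _ _ = \big[addb/false]_(d | dtail d == v)
    ((face d == val f) (+) (face (drev d) == val f))).
  rewrite big_split /= [X in _ (+) X](eq_bigr (fun d => face (r d) == val f)).
    rewrite [X in X (+) _](reindex_inj (@perm_inj _ r)) /=.
    by rewrite (eq_bigl (fun d => dtail d == v)) ?addbb // => d; rewrite dtail_rotation.
  by move=> d _; rewrite face_rotation.
rewrite [RHS]big_mkcond sum_dart; apply: eq_bigr => e _.
rewrite /vertex_inc /face_inc /dtail /drev !FaceE /=.
by do 4!case: (_ == _).
Qed.

Lemma vertex_inc_cst (s : vert G -> bool) :
  (forall e, \big[addb/false]_v (s v && vertex_inc v e) = false) ->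
  forall v w, s v = s w.
Proof.
move=> s0 v w; have [_ _ conn _] := G2.
have /connectP[p vp ->] := conn v w; elim: p v vp => //= y p IH v /andP[vy /IH <-].
have [d <- <-] := adj_dart vy; apply: addb_false_eq.
by rewrite -cutE -sum_vertex_inc.
Qed.

Lemma face_inc_cst (s : ftype -> bool) :
  (forall e, \big[addb/false]_(f : ftype) (s f && face_inc f e) = false) ->
  forall f g : ftype, s f = s g.
Proof.
move=> s0; have srev d : s (Face (drev d)) = s (Face d).
  move: (s0 d.1); rewrite sum_face_inc; case: d => e [] /=;
  by rewrite /drev /=; do 2!case: (s _).
have sr d : s (Face (r d)) = s (Face d).
  by rewrite -[RHS]srev; congr s; apply: val_inj; exact: face_rotation.
have sF := dart_cst sr srev.
have Fs (f : ftype) : exists d, f = Face d.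
  by have /imsetP[d _ fd] := valP f; exists d; apply: val_inj.
by move=> f g; have [d ->] := Fs f; have [d' ->] := Fs g.
Qed.

Lemma card_ftype : #|vert G| + #|ftype| = #|edge G| + 2.
Proof. by rewrite card_sig -(euler D); congr (_ + _); apply: eq_card. Qed.

(** The outer face always counts as outside. *)
Definition inside (s : bface D -> bool) d := oapp s false (dface d).
Definition bdry s e := inside s (e, false) (+) inside s (e, true).

Lemma bdryE s d : bdry s d.1 = inside s d (+) inside s (drev d).
Proof. by case: d => e []; rewrite /bdry /drev //= addbC. Qed.

Lemma even_bdry s : even_set (bdry s).
Proof.
move=> v; under eq_bigr do rewrite bdryE.
rewrite big_split /= [X in _ (+) X](eq_bigr (fun d => inside s (r d))); last first.
  by move=> d _; rewrite /inside /dface face_rotation.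
rewrite [X in X (+) _](reindex_inj (@perm_inj _ r)) /=.
by rewrite (eq_bigl (fun d => dtail d == v)) ?addbb // => d; rewrite dtail_rotation.
Qed.

(** The face boundaries span the cycle space. *)
Lemma even_is_bdry z : even_set z -> exists s, bdry s =1 z.
Proof.
move=> ez.
have [s zs] := incidence_dual incidence_orth card_ftype vertex_inc_cst face_inc_cst
  (fun v => etrans (esym (sum_star z v)) (ez v)).
have outf : outer D \in porbits (face_perm (rotation D)) by exact: outer_face.
have bf f : val f \in porbits (face_perm (rotation D)) by have /andP[] := valP f.
pose o := Ftype outf.
(* Complementing a set of faces keeps its boundary; this is done when [s] contains the outer
   face. *)
pose s' f := s (Ftype (bf f)) (+) s o.
have s'E d : inside s' d = s (Face d) (+) s o.
  rewrite /inside; case fd: (dface d) => [f|] /=; last first.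
    move/eqP: fd; rewrite dface_None outerE => /eqP fo.
    by rewrite (_ : Face d = o) ?addbb //; apply: val_inj.
  move/dfaceP: fd; rewrite porbits_face // => /eqP fd.
  by congr (s _ (+) _); apply: val_inj.
by exists s' => e; rewrite /bdry !s'E addbACA addbb addbF zs sum_face_inc.
Qed.

(** The symmetric difference of the two sets has no boundary, hence contains all faces or none, and
    it misses the outer face. *)
Lemma bdry_inj s s' : bdry s =1 bdry s' -> s =1 s'.
Proof.
move=> ss'; pose P d := inside s d (+) inside s' d.
have Prev d : P (drev d) = P d.
  move: (ss' d.1); rewrite !bdryE /P.
  by do 4!case: (inside _ _).
have Pr d : P (r d) = P d.
  by rewrite -[RHS]Prev /P /inside /dface face_rotation.
have [d0] := imsetP (outer_face D); move=> _ od0.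
have P0 : P d0 = false.
  have /eqP : dface d0 == None by rewrite dface_None od0 porbit_id.
  by rewrite /P /inside => ->.
move=> f; have [d fd] := bface_dart f.
have := dart_cst Pr Prev d d0; rewrite P0 /P /inside fd /=.
by case: (s f); case: (s' f).
Qed.

Lemma faces_even_is_cut z :
  (forall X, X \in porbits phi -> \big[addb/false]_(d in X) z d.1 = false) ->
  exists Y, cut Y =1 z.
Proof.
move=> z0.
have orth (f : ftype) v : \big[addb/false]_e (face_inc f e && vertex_inc v e) = false.
  by rewrite -[RHS](incidence_orth v f); apply: eq_bigr => e _; rewrite andbC.
have z1 (f : ftype) : \big[addb/false]_e (face_inc f e && z e) = false.
  rewrite -[RHS](z0 (val f)) ?(valP f) // [RHS]big_mkcond sum_dart.
  apply: eq_bigr => e _; rewrite /face_inc !porbits_face ?(valP f) //= !FaceE.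
  by do 2!case: (_ == _); case: (z e).
have card_FVE : #|ftype| + #|vert G| = #|edge G| + 2 by rewrite addnC card_ftype.
have [Y zY] := incidence_dual orth card_FVE face_inc_cst vertex_inc_cst z1.
by exists Y => e; rewrite zY sum_vertex_inc.
Qed.

(* Otherwise x would be a cut vertex. *)
Lemma star_cut_cst Y x : (forall e, cut Y e -> incident e x) ->
  forall d d', dtail d = x -> dtail d' = x -> cut Y d.1 = cut Y d'.1.
Proof.
move=> Yx d d' dx d'x; have [_ _ _ /(_ x) conn] := G2.
have hx d1 : dtail d1 = x -> dhead d1 != x by move=> <-; rewrite eq_sym dtail_dhead.
rewrite !cutE dx d'x; congr (_ (+) _).
have /connectP[p] := conn _ _ (hx _ dx) (hx _ d'x).
elim: p (dhead d) => [|y p IH] u /=; first by move=> _ ->.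
move=> /andP[/and3P[ux yx uy] /IH{}IH] /IH <-.
have [d1 d1u d1y] := adj_dart uy; rewrite -d1u -d1y.
apply: addb_false_eq; rewrite -cutE.
by apply/negP=> /Yx; rewrite incidentE d1u d1y (negPf ux) (negPf yx).
Qed.

(** If the outer face left [x] by two darts [d0] and [d'], the edges at [x] from [d0] up to just
    before [d'] in the rotation would meet every face evenly. They would form a cut containing some
    but not all edges at [x], against [star_cut_cst]. *)
Lemma outer_dtail_inj : {in outer D &, injective (@dtail G)}.
Proof.
move=> d0 d' d0o d'o tt'; apply/eqP/negPn/negP => dd'.
set x := dtail d0.
have : d' \in porbit r d0 by rewrite rotation_vertex tt'.
rewrite porbit_traject => /trajectP[[|i] ilt id']; first by rewrite id' eqxx in dd'.
(* [X] runs from [d0] to the dart before [d']; its image [X'] under the rotation loses [d0] and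
   gains [d']. *)
pose X := traject r d0 i.+1; pose X' := traject r (r d0) i.+1.
have eqX : d0 :: X' = rcons X d' by rewrite id' -trajectSr.
have uX : uniq (d0 :: X').
  rewrite -[_ :: _]/(traject r d0 i.+2) -(take_traject _ _ ilt).
  exact/take_uniq/uniq_traject_porbit.
have X'E d : (d \in X') = (d \in X) (+) (d == d0) (+) (d == d').
  have uX2 := uX; rewrite eqX rcons_uniq in uX2; case/andP: uX2 => d'X _.
  case/andP: uX => d0X' _.
  have : (d \in d0 :: X') = (d \in rcons X d') by rewrite eqX.
  rewrite inE mem_rcons inE.
  have [->|dd0] := eqVneq d d0; first by rewrite (negPf d0X') (negPf dd') /= => <-.
  by have [->|dd1] := eqVneq d d'; rewrite ?(negPf d'X) //= => ->; rewrite !addbF.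
have rX d : (r d \in X') = (d \in X).
  have -> : X' = map r X by rewrite /X' /X; elim: i.+1 (d0) => //= n IH u; rewrite IH.
  by rewrite mem_map //; exact: perm_inj.
have Xt d : d \in X -> dtail d = x.
  case/trajectP=> j _ ->; elim: j => //= j IH; by rewrite dtail_rotation.
have Xrev d : d \in X -> drev d \notin X.
  by move=> /Xt dx; apply/negP=> /Xt dx'; move: (dtail_dhead d); rewrite /dhead dx dx' eqxx.
pose z e := ((e, false) \in X) (+) ((e, true) \in X).
have zE d : z d.1 = (d \in X) (+) (drev d \in X).
  by case: d => e []; rewrite /z /drev //= addbC.
have [Y YE] : exists Y, cut Y =1 z.
  (* Along a face, the contributions of [X] and [X'] cancel except at [d0] and [d'], which both lie
     on the outer face. *)
  apply: faces_even_is_cut => F Ff.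
  have phiF d : (phi d \in F) = (d \in F) by rewrite !porbits_face // face_phi.
  under eq_bigr do rewrite zE.
  rewrite big_split /= [X in X (+) _](reindex_inj (@perm_inj _ phi)) /=.
  rewrite (eq_bigl (fun d => d \in F)) // -big_split /=.
  under eq_bigr => d _ do rewrite -(rX (drev d)) -face_permE X'E addbA addbA addbb addFb.
  have -> : \big[addb/false]_(d in F) ((phi d == d0) (+) (phi d == d')) =
    \big[addb/false]_(d in F) ((d == d0) (+) (d == d')).
    by rewrite [RHS](reindex_inj (@perm_inj _ phi)) /=; apply: eq_bigl => d; rewrite phiF.
  have [oF|noF] := eqVneq (outer D) F.
    rewrite (@big_addb2 _ _ _ d0 d') -?oF // ?eqxx ?(negPf dd') 1?eq_sym ?(negPf dd') //.
    by move=> d _ /negPf-> /negPf->.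
  apply: big1 => d dF; move: dF; rewrite porbits_face // => /eqP dF.
  have [dd|_] := eqVneq d d0; first by move: d0o noF; rewrite -dd outerE dF eq_sym => ->.
  by have [dd|//] := eqVneq d d'; move: d'o noF; rewrite -dd outerE dF eq_sym => ->.
have zx e : cut Y e -> incident e x.
  rewrite YE -[e]/((e, false).1) zE => eX.
  have [|eX1] := boolP ((e, false) \in X); first by move/Xt <-; exact: incident_dtail.
  move: eX; rewrite (negPf eX1) /= => /Xt <-; exact: incident_dtail (drev (e, false)).
have := star_cut_cst zx (erefl x) (esym tt').
have d0X : d0 \in X by rewrite /X /= inE eqxx.
have d'X : d' \notin X by move: uX; rewrite eqX rcons_uniq => /andP[].
rewrite !YE !zE d0X (negPf (Xrev _ d0X)) (negPf d'X) /= => /esym/Xt.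
rewrite -/(dhead d') => d'x; have := dtail_dhead d'; by rewrite d'x -tt' eqxx.
Qed.

End Drawing.

(** * The outer cycle and the tree of bounded faces *)

Section OuterCycle.
Variables (G : mgraph) (D : outerplane_drawing G).
Hypothesis G2 : two_connected G.
Implicit Types (d : dart G) (e : edge G) (v x y : vert G) (f g c : bface D).
Let r := rotation D.
Let phi := face_perm r.

(** If both sides of an edge were the same face, this single edge would meet all faces evenly and be
    a cut. By [star_cut_cst] it would be alone at its ends, hence the only edge of the connected
    graph. *)
Lemma face_drev d : face D (drev d) != face D d.
Proof.
apply/negP=> /eqP fd.
have [Y YE] : exists Y, cut Y =1 pred1 d.1.
  apply: (faces_even_is_cut (D := D) G2) => X XF.
  have [dX|dX] := boolP (d \in X); last first.
    apply: big1 => d' d'X; apply/negP=> /eqP /same_edge[dd|dd]; move: dX.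
      by rewrite -dd d'X.
    by rewrite (porbits_face d XF) -fd -dd -(porbits_face d' XF) d'X.
  rewrite (@big_addb2 _ _ _ d (drev d)) //= ?eqxx ?addbb //.
  - by move: dX; rewrite !(porbits_face _ XF) fd.
  - by rewrite eq_sym drev_neq.
  - move=> d' _ d1 d2; apply/negP=> /eqP/same_edge[dd|dd]; first by rewrite dd eqxx in d1.
    by rewrite dd eqxx in d2.
have star x : forall d1 d2, dtail d1 = x -> dtail d2 = x ->
    (d1.1 == d.1) = (d2.1 == d.1).
  move=> d1 d2 d1x d2x.
  have [dx|dx] := boolP (incident d.1 x).
    have := star_cut_cst G2 (Y := Y) (x := x) _ d1x d2x; rewrite !YE; apply.
    by move=> e; rewrite YE /= => /eqP->.
  have N d' : dtail d' = x -> (d'.1 == d.1) = false.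
    by move=> d'x; apply/negP=> /eqP e1; move: dx; rewrite -e1 -d'x incident_dtail.
  by rewrite !N.
have cst := dart_cst (D := D) G2 (P := fun d' => d'.1 == d.1)
  (fun d' => star _ _ _ (dtail_rotation D d') erefl) (fun d' => erefl).
have [_ + _ _] := G2; rewrite ltnNge => /negP; apply.
have sub : {subset predT <= pred1 d.1}.
  by move=> e _; rewrite inE; have /= -> := cst (e, true) d.
by rewrite -(card1 d.1); apply/subset_leq_card/subsetP.
Qed.

Lemma dface_drev d : dface D (drev d) != dface D d.
Proof. by apply/eqP=> /dface_face/eqP; rewrite (negPf (face_drev d)). Qed.

Lemma drev_outer d : d \in outer D -> drev d \notin outer D.
Proof. by rewrite -!dface_None => /eqP d0; rewrite -d0 dface_drev. Qed.

Lemma CoutP e : reflect (exists2 d, d.1 = e & d \in outer D) (e \in Cout D).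
Proof. by apply: (iffP imsetP) => -[d]; exists d. Qed.

Lemma CoutE d : (d.1 \in Cout D) = (d \in outer D) || (drev d \in outer D).
Proof.
apply/CoutP/orP => [[d' /same_edge[->|->]]|[]]; [by left|by right| |].
  by exists d.
by exists (drev d).
Qed.

Lemma dedge_outer_inj : {in outer D &, injective (@dedge G)}.
Proof.
by move=> d d' /drev_outer dN + /same_edge[//|dd]; rewrite -(drevK d') -dd (negPf dN).
Qed.

Lemma card_Cout : #|Cout D| = #|vert G|.
Proof.
rewrite card_in_imset; last exact: dedge_outer_inj.
rewrite -(card_in_imset (outer_dtail_inj (D := D) G2)) -cardsT; congr #|pred_of_set _|.
apply/setP=> v; rewrite inE; apply/imsetP.
by have [d dO <-] := outer_vertex D v; exists d.
Qed.

Lemma card_bface : #|bface D|.+1 = #|porbits phi|.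
Proof.
rewrite card_sig (cardsD1 (outer D)) outer_face add1n; congr _.+1.
by apply: eq_card => X; rewrite !inE andbC.
Qed.

(** By Euler's formula, chords and bounded faces are counted like the edges and vertices of a
    tree. *)
Lemma card_Ein : #|Ein D|.+1 = #|bface D|.
Proof.
have := card_Cout; have := card_bface; have := euler D.
by have := cardsC (Cout D); rewrite /Ein /phi /r; lia.
Qed.

(* The outer face visits every vertex once, so consecutive outer edges are the
   only two outer edges at the vertex between them. *)
Lemma even_Cout_step z d : even_set z -> (forall e, z e -> e \in Cout D) ->
  d \in outer D -> z (phi d).1 = z d.1.
Proof.
move=> ez zC dO; apply/esym/addb_false_eq; rewrite addbC -[RHS](ez (dhead d)).
have phiO d' : (phi d' \in outer D) = (d' \in outer D).
  by rewrite !outerE face_phi.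
rewrite (@big_addb2 _ _ _ (phi d) (drev d)) //.
- by rewrite dtail_phi.
- by apply/eqP=> pd; move: (drev_outer dO); rewrite -pd phiO dO.
move=> d' /eqP d't d'1 d'2; apply/negP=> /zC; rewrite CoutE => /orP[] d'O.
  case/eqP: d'1; apply: (outer_dtail_inj G2 d'O); rewrite ?phiO //.
  by rewrite d't dtail_phi.
case/eqP: d'2; rewrite -[LHS]drevK; congr drev; apply: (@perm_inj _ phi).
by apply: (outer_dtail_inj (D := D) G2); rewrite ?phiO // !dtail_phi dhead_drev d't.
Qed.

Lemma even_Cout_cst z : even_set z -> (forall e, z e -> e \in Cout D) ->
  {in Cout D &, forall e e', z e = z e'}.
Proof.
move=> ez zC e e' /CoutP[d <- dO] /CoutP[d' <-].
have /imsetP[d0 _ oE] := outer_face D.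
have {dO} dO := dO; move: (dO); rewrite {1}oE => dd0.
rewrite oE -(eqP (etrans (eq_porbit_mem _ _ _) dd0)) => /porbitP[n ->].
elim: n => [|n IH]; first by rewrite expg0 perm1.
rewrite expgSr permM even_Cout_step //; elim: n {IH} => [|n IH]; first by rewrite expg0 perm1.
by rewrite expgSr permM outerE (face_phi D) -outerE.
Qed.

Definition chord_adj f g := [exists d, (dface D d == Some f) && (dface D (drev d) == Some g)].

(** The boundary of [A] contains only outer edges, hence all of them or none. Adjoining the outer
    face in the first case gives a set of faces without boundary. *)
Lemma chord_adj_cst (A : bface D -> bool) : (forall f g, chord_adj f g -> A f = A g) ->
  forall f g, A f = A g.
Proof.
move=> Ap.
have [d0 _ d0O] : exists2 d, dtail d = dtail d & d \in outer D.
  by have /imsetP[d _ ->] := outer_face D; exists d => //; exact: porbit_id.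
have zC e : bdry A e -> e \in Cout D.
  move=> zd; rewrite -[e]/((e, true).1) CoutE; move: zd.
  rewrite -[e]/((e, true).1) bdryE -!dface_None /inside.
  case fd: dface => [f|] //=; case fd': dface => [g|] //=.
  by rewrite (Ap f g) ?addbb //; apply/existsP; exists (e, true); rewrite fd fd' !eqxx.
have zcst := even_Cout_cst (even_bdry A) zC.
have d0C : d0.1 \in Cout D by rewrite CoutE d0O.
pose b := bdry A d0.1.
pose P d := inside A d || b && (d \in outer D).
have Prev d : P (drev d) = P d.
  have := bdryE A d; rewrite /P.
  have [dC|dC] := boolP (d.1 \in Cout D); last first.
    rewrite (contraNF (@zC d.1)) //; move: dC; rewrite CoutE negb_or.
    by move=> /andP[/negPf-> /negPf->]; do 2!case: (inside A _).
  rewrite (zcst _ _ dC d0C) -/b.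
  move: dC; rewrite CoutE => /orP[] dO; have dN := drev_outer dO.
    rewrite dO (negPf dN) /inside; move: dO; rewrite -dface_None => /eqP -> /=.
    by move=> ->; case: (oapp _ _ _).
  rewrite drevK in dN.
  rewrite dO (negPf dN) /inside; move: dO; rewrite -dface_None => /eqP -> /=.
  by move=> ->; case: (oapp _ _ _).
have Pr d : P (r d) = P d.
  by rewrite -[RHS]Prev /P /inside -!dface_None /dface face_rotation.
have Ab f : A f = b.
  have [d fd] := bface_dart f.
  have := dart_cst (D := D) G2 Pr Prev d d0; rewrite /P d0O andbT -!dface_None /inside fd /= andbF orbF.
  by move: d0O; rewrite -dface_None => /eqP -> /= ->.
by move=> f g; rewrite !Ab.
Qed.

Lemma chord_adj_connect c f : connect chord_adj c f.
Proof.
rewrite (chord_adj_cst (A := connect chord_adj c) _ f c) ?connect0 // => g h gh.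
apply/idP/idP => [cg|ch]; first exact: connect_trans cg (connect1 gh).
apply: connect_trans ch (connect1 _); move: gh => /existsP[d /andP[dg dh]].
by apply/existsP; exists (drev d); rewrite drevK dg dh.
Qed.

(* The faces other than c correspond to the chords: pe f separates f from its
   parent. That every chord is obtained is a matter of counting. *)
Record rooted c (up : bface D -> bface D) (h : bface D -> nat) (pe : bface D -> edge G)
    : Prop := Rooted {
  rt_root : h c = 0;
  rt_up : forall f, f != c -> h f = (h (up f)).+1;
  rt_edge : forall f, f != c ->
    exists2 d, d.1 = pe f & dface D d = Some f /\ dface D (drev d) = Some (up f);
  rt_chord : forall e, e \in Ein D -> exists2 f, f != c & e = pe f
}.

Fixpoint reach c n f :=
  if n is m.+1 then [exists g, reach c m g && chord_adj g f] else f == c.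

Lemma reach_connect c f : exists n, reach c n f.
Proof.
have /connectP[p cp ->] := chord_adj_connect c f.
elim/last_ind: p cp => [|p g IH]; first by exists 0 => /=.
rewrite rcons_path last_rcons => /andP[/IH[n cn] pg].
by exists n.+1; apply/existsP; exists (last c p); apply/andP; split.
Qed.

Lemma EinP e : reflect (exists f g d, [/\ d.1 = e, dface D d = Some f & dface D (drev d) = Some g])
  (e \in Ein D).
Proof.
rewrite inE -[e]/((e, true).1) CoutE -!dface_None negb_or.
apply: (iffP andP) => [[]|[f [g [d [/same_edge[<-|dd] d1 d2]]]]].
- case fd: dface => [f|] // ; case fd': dface => [g|] // _.
  by exists f, g, (e, true).
- by rewrite d1 d2.
- by rewrite -[(e, true)]drevK -dd d1 d2.
Qed.

(** Breadth-first search from [c]. The parent chords are distinct and as many as the chords, so they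
    are all the chords. *)
Lemma exists_rooted c : exists up h pe, rooted c up h pe.
Proof.
pose h f := ex_minn (reach_connect c f).
have hr f : reach c (h f) f by rewrite /h; case: ex_minnP.
have hm f n : reach c n f -> h f <= n by rewrite /h; case: ex_minnP => m _ + /[dup] => H /H.
have hc : h c = 0 by apply/eqP; rewrite -leqn0; apply: hm => /=.
have [up upP] : exists up : bface D -> bface D, forall f, f != c ->
    h f = (h (up f)).+1 /\ chord_adj (up f) f.
  apply: (@fin_all_exists _ _ (fun f g => f != c -> h f = (h g).+1 /\ chord_adj g f)) => f.
  case hf: (h f) (hr f) => [|n] /=; first by move=> /eqP->; exists c; rewrite eqxx.
  case/existsP=> g /andP[ng gf]; exists g => _; split=> //; congr _.+1.
  apply/eqP; rewrite eqn_leq (hm _ _ ng) andbT -ltnS -hf; apply: hm.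
  by apply/existsP; exists g; apply/andP; split.
have [pe peP] : exists pe : bface D -> edge G, forall f, f != c ->
    exists2 d, d.1 = pe f & dface D d = Some f /\ dface D (drev d) = Some (up f).
  apply: (@fin_all_exists _ _ (fun f e => f != c ->
    exists2 d, d.1 = e & dface D d = Some f /\ dface D (drev d) = Some (up f))) => f.
  have [->|fc_] := eqVneq f c.
    by have [d _] := bface_dart c; exists d.1.
  have [_ /existsP[d /andP[/eqP d1 /eqP d2]]] := upP f fc_.
  by exists d.1 => _; exists (drev d); rewrite ?drevK.
(* Two faces with the same parent chord would be each other's parent, which the depths forbid. *)
have pe_inj : {in [set~ c] &, injective pe}.
  move=> f g; rewrite !inE => fc gc.
  have [d <- [d1 d2]] := peP f fc; have [d' <- [d1' d2']] := peP g gc.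
  case/same_edge=> dd; first by move: d1; rewrite dd d1' => -[].
  have [hf _] := upP f fc; have [hg _] := upP g gc.
  move: d1 d2; rewrite dd drevK d2' d1' => -[upg] [upf].
  by move: hf hg; rewrite upg -upf; lia.
exists up, h, pe; split=> // [f /upP[] //|].
have sub : pe @: [set~ c] \subset Ein D.
  apply/subsetP=> _ /imsetP[f + ->]; rewrite in_setC1 => fc.
  by have [d de [d1 d2]] := peP f fc; apply/EinP; exists f, (up f), d.
have /eqP Epe : pe @: [set~ c] == Ein D.
  by rewrite eqEcard sub card_in_imset // cardsC1; have := card_Ein; lia.
by move=> e; rewrite -Epe => /imsetP[f + ->]; rewrite in_setC1; exists f.
Qed.

Section Rooted.
Variables (c : bface D) (up : bface D -> bface D) (h : bface D -> nat).
Variable pe : bface D -> edge G.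
Hypothesis rt : rooted c up h pe.

Lemma chord_cases d f g : dface D d = Some f -> dface D (drev d) = Some g ->
  [/\ f != c, d.1 = pe f & g = up f] \/ [/\ g != c, d.1 = pe g & f = up g].
Proof.
move=> d1 d2.
have /(rt_chord rt)[f' f'c e] : d.1 \in Ein D by apply/EinP; exists f, g, d.
have [d' d'e [d1' d2']] := rt_edge rt f'c.
have /same_edge[dd|dd] : d.1 = d'.1 by rewrite e d'e.
  by left; move: d1 d2; rewrite dd d1' d2' => -[<-] [<-].
by right; move: d1 d2; rewrite dd drevK d1' d2' => -[<-] [<-].
Qed.

Lemma bdry_pe s f : f != c -> bdry s (pe f) = s f (+) s (up f).
Proof.
by move=> fc; have [d <- [d1 d2]] := rt_edge rt fc; rewrite bdryE /inside d1 d2.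
Qed.

Lemma bdry_outer s d f : dface D d = Some f -> drev d \in outer D -> bdry s d.1 = s f.
Proof. by move=> df; rewrite -dface_None bdryE /inside df => /eqP-> /=; rewrite addbF. Qed.

Lemma edge_cases e : (exists2 f, f != c & e = pe f) \/
  (exists f d, [/\ d.1 = e, dface D d = Some f & drev d \in outer D]).
Proof.
have [/CoutP[d <- dO]|eC] := boolP (e \in Cout D); last first.
  by left; apply: (rt_chord rt); rewrite inE.
right; have := drev_outer dO; rewrite -dface_None.
case df: dface => [f|] // _; exists f, (drev d); by rewrite drevK.
Qed.

Definition outer_at f := [exists d, (dface D d == Some f) && (drev d \in outer D)].

Lemma outer_atP f : reflect (exists2 d, dface D d = Some f & drev d \in outer D) (outer_at f).
Proof.
by apply: (iffP existsP) => [[d /andP[/eqP]]|[d /eqP d1 d2]]; exists d => //; rewrite d1.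
Qed.

Lemma phi_edge d : (phi d).1 != d.1.
Proof.
apply/eqP=> /same_edge[] dd.
  have := dtail_phi D d; rewrite dd => dh; have := dtail_dhead d; by rewrite dh eqxx.
by have := face_phi D d; rewrite dd => /eqP; rewrite (negPf (face_drev d)).
Qed.

(* Take a descendant of maximal depth: apart from its parent chord, its
   boundary contains only outer edges. *)
Lemma outer_descendant f : exists2 u, anc up h f u & outer_at u.
Proof.
have a0 := anc_refl up h.
case: (arg_maxnP h (a0 f : (fun u => anc up h f u) f)) => u fu umax; exists u => //.
have [d0 d0u] := bface_dart u.
have [d [du dpe]] : exists d, dface D d = Some u /\ (u != c -> d.1 != pe u).
  have [e|ne] := eqVneq d0.1 (pe u); last by exists d0.
  exists (phi d0); rewrite -e phi_edge; split=> //.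
  by rewrite -d0u /dface face_phi.
apply/outer_atP; exists d => //; rewrite -dface_None.
case d2: (dface D (drev d)) => [g|] //.
have [[uc]|[gc _ ug]] := chord_cases du d2; first by move=> /eqP; rewrite (negPf (dpe uc)).
have /umax : anc up h f g.
  apply: (anc_trans (rt_root rt) (rt_up rt) fu).
  by rewrite (anc_up (rt_up rt)) // -ug a0 orbT.
by rewrite (rt_up rt gc) -ug /=; lia.
Qed.

End Rooted.
End OuterCycle.

(** * Cycles *)

Lemma uniq_map_inj (T1 T2 : eqType) (f : T1 -> T2) s :
  uniq (map f s) -> {in s &, injective f}.
Proof.
elim: s => //= x s IH /andP[fx /IH{}IH] y z; rewrite !inE.
case/orP=> [/eqP->|ys] /orP[/eqP->|zs] // e; last exact: IH.
  by case/mapP: fx; exists z.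
by case/mapP: fx; exists y.
Qed.

Section Cycles.
Variable G : mgraph.
Implicit Types (d : dart G) (e : edge G) (v x y : vert G) (M N : {set edge G}).

Lemma perfectP M : perfect_matching M <->
  forall v, exists m, [/\ dtail m = v, m.1 \in M
                      & forall d, dtail d = v -> d.1 \in M -> d = m].
Proof.
split=> PM v.
  have /eqP/cards1P[e eM] := PM v.
  have := set11 e; rewrite -eM inE => /andP[eM1 /incident_dart[m me mv]].
  exists m; split; rewrite ?me // => d dv dM.
  have : d.1 \in [set e] by rewrite -eM inE dM -dv incident_dtail.
  rewrite inE -me => /eqP/same_edge[//|dd].
  by have := dtail_dhead m; rewrite mv -dv dd eqxx.
have [m [mv mM mU]] := PM v; apply/eqP/cards1P; exists m.1; apply/setP=> e.
rewrite !inE; apply/andP/eqP=> [[eM /incident_dart[d de dv]]|->].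
  by rewrite -de (mU d) // de.
by rewrite mM -mv incident_dtail.
Qed.

Lemma perfect_sum M v : perfect_matching M ->
  \big[addb/false]_(d | dtail d == v) (d.1 \in M) = true.
Proof.
move=> /perfectP/(_ v)[m [mv mM mU]].
rewrite (@big_addb1 _ _ _ m) ?mv // => d /eqP dv dm.
by apply/negP=> /(mU d dv) e; rewrite e eqxx in dm.
Qed.

Lemma even_symdiff M N : perfect_matching M -> perfect_matching N ->
  even_set (fun e => (e \in M) (+) (e \in N)).
Proof. by move=> PM PN v; rewrite big_split /= !perfect_sum. Qed.

Lemma in_symdiff M N e : (e \in symdiff M N) = (e \in M) (+) (e \in N).
Proof. by rewrite !inE; case: (e \in M); case: (e \in N). Qed.

Lemma cycle_heads (c : seq (dart G)) :
  path.cycle (fun d d' => dhead d == dtail d') c ->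
  map (@dhead G) c = rot 1 (map (@dtail G) c).
Proof.
case: c => // d c; rewrite /= rot1_cons -map_rcons.
by elim: c {1 3}d => /= [|d' c IH] d1 /andP[/eqP-> dc]; rewrite ?IH.
Qed.

Section Cycle.
Variable c : seq (dart G).
Hypothesis c_cycle : cycle_darts c.

Let c_adj : path.cycle (fun d d' => dhead d == dtail d') c.
Proof. by have /and4P[] := c_cycle. Qed.

Lemma cycle_dtail_inj : {in c &, injective (@dtail G)}.
Proof. by have /and4P[_ _ + _] := c_cycle; exact: uniq_map_inj. Qed.

Lemma cycle_dhead_inj : {in c &, injective (@dhead G)}.
Proof.
by apply: uniq_map_inj; rewrite cycle_heads // rot_uniq; have /and4P[] := c_cycle.
Qed.

Lemma cycle_dedge_inj : {in c &, injective (@dedge G)}.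
Proof. by have /and4P[_ _ _] := c_cycle; exact: uniq_map_inj. Qed.

Lemma cycle_drev d : d \in c -> drev d \notin c.
Proof.
move=> dc; apply/negP=> dc'.
by have := drev_neq d; rewrite (cycle_dedge_inj dc' dc erefl) eqxx.
Qed.

Lemma mem_cycle d : (d.1 \in map (@dedge G) c) = (d \in c) || (drev d \in c).
Proof.
apply/mapP/orP => [[d' d'c /same_edge[->|->]]|[]dc].
- by left.
- by right; rewrite drevK.
- by exists d.
- by exists (drev d).
Qed.

Lemma cycle_at v : (exists d d', [/\ d \in c, d' \in c, dhead d = v & dtail d' = v]) \/
  (forall d, dtail d = v -> d.1 \notin map (@dedge G) c).
Proof.
have hE u : (u \in map (@dhead G) c) = (u \in map (@dtail G) c).
  by rewrite cycle_heads // mem_rot.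
have [|vc] := boolP (v \in map (@dhead G) c).
  move=> /[dup] /mapP[d dc ->]; rewrite hE => /mapP[d' d'c e].
  by left; exists d, d'.
right=> d dv; apply: contra vc; rewrite mem_cycle => /orP[]dc.
  by rewrite hE -dv map_f.
by rewrite -dv -dhead_drev map_f.
Qed.

Lemma cycle_star d d' (d1 : dart G) : d \in c -> d' \in c -> dhead d = dtail d' ->
  dtail d1 = dtail d' -> (d1.1 \in map (@dedge G) c) = (d1 == d') || (d1 == drev d).
Proof.
move=> dc d'c dd' d1d'; rewrite mem_cycle; apply/orP/orP => -[].
- by move=> d1c; left; apply/eqP/cycle_dtail_inj.
- move=> d1c; right; rewrite -(drevK d1); apply/eqP; congr drev.
  by apply: cycle_dhead_inj => //; rewrite dhead_drev d1d'.
- by move/eqP->; left.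
- by move/eqP->; right; rewrite drevK.
Qed.

Lemma cycle_turn d d' : d \in c -> d' \in c -> d' != drev d.
Proof. by move=> dc d'c; apply/eqP=> e; have := cycle_drev dc; rewrite -e d'c. Qed.

Lemma cycle_star_sum (z : edge G -> bool) d d' :
  (forall e, z e -> e \in map (@dedge G) c) ->
  d \in c -> d' \in c -> dhead d = dtail d' ->
  \big[addb/false]_(d1 | dtail d1 == dtail d') z d1.1 = z d'.1 (+) z d.1.
Proof.
move=> zc dc d'c dd'; rewrite (@big_addb2 _ _ _ d' (drev d)) //.
- exact/eqP.
- exact: cycle_turn.
move=> d1 /eqP d1t d1d' d1d; apply/negP=> /zc.
by rewrite (cycle_star dc d'c dd' d1t) (negPf d1d') (negPf d1d).
Qed.

Lemma even_cycle : even_set (fun e => e \in map (@dedge G) c).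
Proof.
move=> v; have [[d [d' [dc d'c dv d'v]]]|none] := cycle_at v; last first.
  by apply: big1 => d /eqP/none/negPf.
rewrite -d'v (@cycle_star_sum (fun e => e \in map (@dedge G) c) d d') ?d'v //.
by rewrite /= !mem_cycle dc d'c.
Qed.

(** At each vertex of the cycle, an even subset of its edges contains both or neither of the two
    cycle edges. *)
Lemma even_sub_cycle (z : edge G -> bool) : even_set z ->
  (forall e, z e -> e \in map (@dedge G) c) ->
  {in map (@dedge G) c &, forall e e', z e = z e'}.
Proof.
move=> ez zc.
have : path.cycle (fun d d' => z d.1 == z d'.1) c.
  apply: (@sub_in_cycle _ (mem c)) c_adj; last exact/allP.
  move=> d d' dc d'c /= /eqP dd'; apply/eqP/esym/addb_false_eq.
  by rewrite -(cycle_star_sum zc dc d'c dd') ez.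
case: c => // d0 p; rewrite /= rcons_path => /andP[pz _].
have /allP zp : all (fun d => z d0.1 == z d.1) p.
  by apply: order_path_min pz => ? ? ? /eqP-> /eqP->.
have z0 e : e \in map (@dedge G) (d0 :: p) -> z e = z d0.1.
  by case/mapP=> d + ->; rewrite inE => /orP[/eqP->//|/zp/eqP->].
by move=> e e' /z0-> /z0->.
Qed.

Section Alternating.
Variable M : {set edge G}.
Hypothesis M_perfect : perfect_matching M.

(** If the matching edge at each vertex of the cycle is one of the two cycle edges there, the other
    one is outside [M]. *)
Lemma alternatingP :
  (forall d, d.1 \in map (@dedge G) c ->
     exists m, [/\ dtail m = dtail d, m.1 \in M & m.1 \in map (@dedge G) c]) ->
  alternating_darts M c.
Proof.
move=> Mc; apply: (@sub_in_cycle _ (mem c)) c_adj; last exact/allP.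
move=> d d' dc d'c /= /eqP dd'.
have [|m [md' mM]] := Mc d'; first by rewrite mem_cycle d'c.
have [m' [m't m'M m'U]] := (perfectP M).1 M_perfect (dtail d').
have U d1 : dtail d1 = dtail d' -> d1.1 \in M -> d1 = m.
  by move=> d1t d1M; rewrite (m'U _ d1t d1M) (m'U m).
rewrite (cycle_star dc d'c dd' md') => /orP[]/eqP em.
  have [dM|] := boolP (d.1 \in M); last by rewrite /dedge -em mM.
  by have := cycle_turn dc d'c; rewrite -em (U (drev d)) ?eqxx.
have [dM|dM] := boolP (d'.1 \in M).
  by have := cycle_turn dc d'c; rewrite (U d') ?em ?eqxx.
by rewrite /dedge -[d.1]/((drev d).1) -em mM.
Qed.

Lemma perfect_flip : alternating_darts M c ->
  perfect_matching (symdiff M [set e in map (@dedge G) c]).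
Proof.
move=> alt; apply/perfectP => v.
have [m [mv mM mU]] := (perfectP M).1 M_perfect v.
have inC e : (e \in symdiff M [set e in map (@dedge G) c]) =
    (e \in M) (+) (e \in map (@dedge G) c) by rewrite in_symdiff inE.
have [[d [d' [dc d'c dv d'v]]]|none] := cycle_at v; last first.
  exists m; split=> // [|d dv]; rewrite inC (negPf (none _ _)) // addbF //.
  exact: mU.
have dd' : dhead d = dtail d' by rewrite dv.
pose next d := path.next c d.
have altd : (d.1 \in M) != (d'.1 \in M).
  have nc := next_cycle c_adj dc; have na := next_cycle alt dc.
  rewrite -(cycle_dtail_inj _ d'c (etrans (esym (eqP nc)) dd')) ?mem_next //.
have revv : dtail (drev d) = v by [].
have [dM|dM] := boolP (d.1 \in M).
  exists d'; split=> //.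
    by move: altd; rewrite inC dM mem_cycle d'c; case: (_ \in M).
  move=> d1 d1v; rewrite inC (cycle_star dc d'c dd') ?d1v //.
  have [//|_] := eqVneq d1 d'; have [->|d1d] := eqVneq d1 (drev d); first by rewrite /= dM.
  by rewrite addbF => d1M; have := mU _ d1v d1M; rewrite -(mU _ revv dM) => e; rewrite e eqxx in d1d.
have d'M : d'.1 \in M by move: altd; rewrite (negPf dM); case: (_ \in M).
exists (drev d); split=> //.
  by rewrite inC (negPf dM) mem_cycle drevK dc orbT.
move=> d1 d1v; rewrite inC (cycle_star dc d'c dd') ?d1v //.
have [->|d1d'] := eqVneq d1 d'; first by rewrite d'M.
have [->//|_] := eqVneq d1 (drev d).
by rewrite addbF => d1M; have := mU _ d1v d1M; rewrite -(mU _ d'v d'M) => e; rewrite e eqxx in d1d'.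
Qed.

End Alternating.
End Cycle.

(** Even degrees allow a walk in [z] that never turns back; its first repeated vertex closes a
    cycle. *)
Lemma exists_cycle (z : edge G -> bool) d0 : even_set z -> z d0.1 ->
  exists c, cycle_darts c /\ forall d, d \in c -> z d.1.
Proof.
move=> ez z0.
pose ok d d' := [&& dtail d' == dhead d, d'.1 != d.1 & z d'.1].
pose nxt d := odflt d [pick d' | ok d d'].
have nxtP d : z d.1 -> ok d (nxt d).
  rewrite /nxt; case: pickP => //= none zd.
  have := ez (dhead d); rewrite (@big_addb1 _ _ _ (drev d)) ?zd //.
  move=> d' /eqP d't d'd; have := none d'; rewrite /ok d't eqxx /=.
  case: (z d'.1); rewrite ?andbF // andbT => /negbFE/eqP/same_edge[e|e].
    by have := dtail_dhead d; rewrite -d't e eqxx.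
  by rewrite e eqxx in d'd.
have zi k : z (iter k nxt d0).1 by elim: k => //= k /nxtP/and3P[].
pose t k := dtail (iter k nxt d0).
have ex_rep : exists j, ~~ uniq (mkseq t j.+1).
  exists #|vert G|; apply/negP=> /card_uniqP; rewrite size_mkseq => e.
  by have := max_card (mem (mkseq t #|vert G|.+1)); rewrite e ltnn.
case: (ex_minnP ex_rep) => j jrep jmin.
have tu : uniq (mkseq t j).
  by case: j {jrep} jmin => // j /(_ j); case: uniq => // /(_ isT); rewrite ltnn.
have [i ij tij] : exists2 i, i < j & t i = t j.
  move: jrep; rewrite /mkseq -addn1 iotaD map_cat cats1 rcons_uniq.
  rewrite -/(mkseq t j) tu andbT negbK => /mapP[i]; rewrite mem_iota add0n => ij e.
  by exists i.
have tinj k l : k < j -> l < j -> t k = t l -> k = l.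
  by move=> kj lj; apply: (uniq_map_inj tu); rewrite mem_iota.
have th k : dhead (iter k nxt d0) = t k.+1.
  by have /and3P[/eqP<-] := nxtP _ (zi k).
pose c := [seq iter k nxt d0 | k <- iota i (j - i)].
exists c; split; last by move=> d /mapP[k _ ->].
have einj : {in iota i (j - i) &, injective (fun k => (iter k nxt d0).1)}.
  suff lt k l : i <= k -> k < l -> l < j -> (iter k nxt d0).1 != (iter l nxt d0).1.
    move=> k l; rewrite !mem_iota => ik il e.
    have [kl|lk|//] := ltngtP k l.
      by have := lt k l; rewrite e eqxx => /(_ _ kl); lia.
    by have := lt l k; rewrite e eqxx => /(_ _ lk); lia.
  move=> ik kl lj; apply/eqP=> /same_edge[e|e].
    have := tinj k l _ lj; rewrite /t e => /(_ _ erefl); lia.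
  (* Dart [l] now reverses dart [k], so its tail is the head of [k]. Distinct tails force l = k + 1,
     and the walk would turn back. *)
  have [_ ne _] := and3P (nxtP _ (zi k)).
  have := tinj l k.+1 lj; rewrite -th e dhead_drev => /(_ _ erefl) => lk1.
  have {}lk1 : l = k.+1 by apply: lk1; lia.
  by move: ne; rewrite -iterS -lk1 e eqxx.
apply/and4P; split.
- by rewrite /c -size_eq0 size_map size_iota subn_eq0 -ltnNge.
- rewrite /c -(subnSK ij) /= .
  set m := j - i.+1.
  rewrite rcons_path; apply/andP; split.
    elim: m i.+1 {1 3}i (erefl i.+1) => //= m IH _ i1 <-.
    by rewrite th eqxx IH.
  have -> : last (iter i nxt d0) [seq iter k nxt d0 | k <- iota i.+1 m] = iter (i + m) nxt d0.
    rewrite (last_map (fun k => iter k nxt d0)); congr iter.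
    by case: m => [|m]; rewrite ?addn0 // -[m.+1]addn1 iotaD last_cat /= addn1 addSn addnS.
  rewrite th -[dtail _]/(t i) tij; apply/eqP; congr t; rewrite /m; lia.
- rewrite -map_comp map_inj_in_uniq ?iota_uniq // => k l.
  rewrite !mem_iota => kij lij; apply: tinj; lia.
- by rewrite -map_comp map_inj_in_uniq ?iota_uniq.
Qed.

(** A cycle inside [z] is itself a nonempty even set, so by minimality it is all of [z]. *)
Lemma minimal_even_cycle (z : edge G -> bool) d0 : even_set z -> z d0.1 ->
  (forall z', even_set z' -> (forall e, z' e -> z e) ->
     (exists e, z' e) -> forall e, z e -> z' e) ->
  exists2 c, cycle_darts c & forall e, (e \in map (@dedge G) c) = z e.
Proof.
move=> ez z0 zmin; have [c [cc cz]] := exists_cycle ez z0; exists c => // e.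
have sub e' : e' \in map (@dedge G) c -> z e' by move=> /mapP[d /cz zd ->].
apply/idP/idP => [/sub//|]; apply: (zmin _ (even_cycle cc)) => //.
have /and4P[] := cc; case: c {cc cz sub} => // d c _ _ _ _.
by exists d.1; rewrite /= inE eqxx.
Qed.

End Cycles.

(** * Reversing the boundary of a region *)

Section Regions.
Variables (G : mgraph) (D : outerplane_drawing G).
Hypothesis G2 : two_connected G.
Implicit Types (d : dart G) (e : edge G) (v x y : vert G) (f g : bface D).
Implicit Types (M N : {set edge G}) (s F : bface D -> bool).

Lemma inside_addb s F d : inside (fun f => s f (+) F f) d = inside s d (+) inside F d.
Proof. by rewrite /inside; case: (dface _ _). Qed.

Lemma bdry_addb s F e : bdry (fun f => s f (+) F f) e = bdry s e (+) bdry F e.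
Proof. by rewrite /bdry !inside_addb addbACA. Qed.

Lemma eq_bdry s s' : s =1 s' -> bdry s =1 bdry s'.
Proof.
move=> ss e; have eq_st d : inside s d = inside s' d by rewrite /inside; case: (dface D d) => /=.
by rewrite /bdry !eq_st.
Qed.

Lemma bdry0 e : bdry (fun _ : bface D => false) e = false.
Proof. by rewrite /bdry /inside; do 2!case: (dface _ _). Qed.

Lemma bdry_eq0 s : (forall e, bdry s e = false) -> forall f, s f = false.
Proof. by move=> s0; apply: (bdry_inj G2) => e; rewrite bdry0. Qed.

Variables (c : bface D) (up : bface D -> bface D) (h : bface D -> nat).
Variable pe : bface D -> edge G.
Hypothesis rt : rooted c up h pe.
Let h_root := rt_root rt.
Let h_up := rt_up rt.

(** For sets containing the root, this is connectedness in the tree of faces. *)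
Definition up_closed F := forall f, f != c -> F f -> F (up f).

Lemma up_closed_anc F f u : up_closed F -> anc up h f u -> F u -> F f.
Proof.
move=> Fup; elim/(tree_ind h_up): u => [|u uc IH].
  by rewrite (anc_root _ h_root) => /eqP->.
by rewrite (anc_up h_up) // => /orP[/eqP->//|/IH fu /(Fup _ uc)].
Qed.

(* Inside F and inside each component of its complement no edge of bdry F is
   crossed, and each such component contains an outer edge. *)
Lemma up_closed_minimal F z : F c -> up_closed F -> even_set z ->
  (forall e, z e -> bdry F e) -> (exists e, z e) -> forall e, bdry F e -> z e.
Proof.
move=> Fc Fup ez zF [e0 ze0].
have [A Az] := even_is_bdry D G2 ez.
have Aup f : f != c -> F f = F (up f) -> A f = A (up f).
  move=> fc e; apply: addb_false_eq; rewrite -(bdry_pe rt _ fc) Az.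
  by apply/negP=> /zF; rewrite (bdry_pe rt _ fc) e addbb.
have AF f : F f -> A f = A c.
  elim/(tree_ind h_up): f => [//|f fc IH Ff].
  by rewrite Aup ?IH ?Ff ?Fup.
have AN f : F f = false -> A f = false.
  move=> Ff; have [u fu /outer_atP[d du dO]] := outer_descendant G2 rt f.
  have {}Ff g : anc up h f g -> F g = false.
    by move=> fg; apply: contraFF Ff; exact: up_closed_anc.
  have -> : A f = A u.
    elim/(tree_ind h_up): (u) fu => [|g gc IH].
      by rewrite (anc_root _ h_root) => /eqP->.
    move=> fg; move: (fg); rewrite (anc_up h_up) // => /orP[/eqP->//|fg'].
    by rewrite IH // [RHS]Aup // !Ff.
  rewrite -(bdry_outer A du dO) Az; apply/negP=> /zF.
  by rewrite (bdry_outer _ du dO) Ff.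
have Ac : A c.
  apply: contraT => /negPf Ac; rewrite -Az in ze0.
  suff A0 : A =1 (fun=> false) by move: ze0; rewrite (eq_bdry A0) bdry0.
  by move=> f; have [/AF->//|/negbTE/AN] := boolP (F f).
have AEF : A =1 F.
  by move=> f; have [/AF->//|/negbTE/AN] := boolP (F f).
by move=> e; rewrite -Az (eq_bdry AEF).
Qed.

(** If [F] contained [f] but not its parent, the part of [F] under [f] would have a nonempty
    boundary inside the cycle, hence the whole cycle as boundary. It would then equal [F], although
    it misses the root. *)
Lemma cycle_up_closed F b : cycle_darts b ->
  (forall e, (e \in map (@dedge G) b) = bdry F e) -> F c -> up_closed F.
Proof.
move=> bc bF Fc f fc Ff; apply: contraT => Fup.
pose A g := F g && anc up h f g.
have AF e : bdry A e -> bdry F e.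
  case: (edge_cases G2 rt e) => [[g gc ->]|[g [d [<- dg dO]]]].
    rewrite !(bdry_pe rt _ gc) /A (anc_up h_up) //.
    by have [<-|_] := eqVneq f g; [rewrite Ff (negPf Fup)|case: anc; rewrite ?andbT ?andbF].
  by rewrite !(bdry_outer _ dg dO) => /andP[].
have pA : bdry A (pe f) by rewrite (bdry_pe rt _ fc) /A Ff (negPf Fup) anc_refl.
have AEF : bdry A =1 bdry F.
  move=> e; apply/idP/idP=> [/AF//|eF].
  suff -> : bdry A e = bdry A (pe f) by [].
  apply: (even_sub_cycle bc (even_bdry A)); rewrite ?bF //; last exact: AF.
  by move=> e1 /AF; rewrite bF.
have := bdry_inj G2 AEF c; rewrite /A Fc (anc_root _ h_root).
by rewrite (negPf fc).
Qed.

Lemma up_closed_dist F f : F c -> up_closed F -> dist up h F f = ~~ F f.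
Proof.
move=> Fc Fup; elim/(tree_ind h_up): f => [|f fc IH].
  by rewrite (dist_root _ h_root) Fc.
rewrite (dist_up h_up) // IH; have := Fup f fc.
by case: (F f) => [->|_] //; case: (F (up f)).
Qed.

Section Flip.
Variables (M N : {set edge G}) (s : bface D -> bool) (k : nat).
Hypothesis M_perfect : perfect_matching M.
Hypothesis N_perfect : perfect_matching N.
Hypothesis bdry_s : forall e, bdry s e = (e \in M) (+) (e \in N).
Hypothesis s_root : s c = odd k.+1.
Let ds := dist up h s.
Hypothesis ds_le : forall f, ds f <= k.+1.
Hypothesis chord_MN : forall f, f != c -> pe f \in M -> pe f \in N -> ds f = k.+1.

(** Here [k.+1] is the half gap of the overview. The root is exempted because [pe c] is a dummy. *)
Definition good f := (f == c) || (pe f \notin M) && (ds f < k.+1).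
Definition region := all_up up h good.

Lemma region_root : region c.
Proof. by rewrite /region (all_up_root _ h_root) /good eqxx. Qed.

Lemma region_up f : f != c -> region f = [&& pe f \notin M, ds f < k.+1 & region (up f)].
Proof.
by move=> fc; rewrite /region (all_up_up h_up) // /good (negPf fc) andbA.
Qed.

Lemma region_up_closed : up_closed region.
Proof. by move=> f /region_up-> /and3P[]. Qed.

Lemma region_dist f : region f -> ds f < k.+1.
Proof.
have [->|/region_up->/and3P[]//] := eqVneq f c.
by rewrite /ds (dist_root _ h_root).
Qed.

(** In particular, the faces at the extreme distance [k.+1] lie outside [s]. *)
Lemma ds_parity f : s f = odd k.+1 (+) odd (ds f).
Proof. by rewrite /ds (odd_dist h_root h_up) s_root addbC addbK. Qed.

(** A chord leaving the region is in [M] or leads to distance [k.+1]. In the latter case the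
    distance has grown; in the former [s] changes unless the chord is also in [N], and then
    [chord_MN] again gives distance [k.+1]. *)
Lemma region_exit f : f != c -> ~~ region f -> region (up f) ->
  s f (+) s (up f) /\ (pe f \in M \/ ds f = k.+1).
Proof.
move=> fc Rf Ruf; have du := region_dist Ruf.
have dE : ds f = (s f (+) s (up f)) + ds (up f) by rewrite /ds (dist_up h_up).
have [fM|fM] := boolP (pe f \in M); last first.
  have df : ds f = k.+1.
    apply/eqP; rewrite eqn_leq ds_le; move: Rf; rewrite region_up // fM Ruf andbT /=.
    by rewrite -leqNgt.
  by split; [move: dE; rewrite df; case: addb => //; lia | right].
split; last by left.
have [fN|fN] := boolP (pe f \in N); last by rewrite -(bdry_pe rt) // bdry_s fM (negPf fN).
by move: dE; rewrite (chord_MN fc fM fN); case: (s f (+) _) => //; lia.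
Qed.

Lemma bdry_region f : f != c -> bdry region (pe f) = ~~ region f && region (up f).
Proof.
move=> fc; rewrite (bdry_pe rt) //; have := region_up_closed fc.
by case: (region f) => [->|] //.
Qed.

Lemma bdry_region_M f : f != c -> pe f \in M -> bdry region (pe f) = false -> region (up f) = false.
Proof.
by move=> fc fM; rewrite bdry_region // region_up // fM /=.
Qed.

Lemma outer_Cout d : d.1 \in Cout D -> exists f d', [/\ d'.1 = d.1, dface D d' = Some f & drev d' \in outer D].
Proof.
case: (edge_cases G2 rt d.1) => // -[f fc e] /CoutP[d' e' d'O].
have [d1 d1e [d1f d1u]] := rt_edge rt fc.
move: d'O; rewrite -dface_None.
by case: (same_edge (d := d') (d' := d1)) => [|->|->]; rewrite ?d1f ?d1u // e' e.
Qed.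

(* If the M-edge at v were not on the boundary of the region, then the two
   boundary edges at v would be, up to exchange, an N-edge leading to distance
   k + 1 and an outer edge, or two outer edges. In the first case the boundary of
   [region] /\ [s] has odd degree at v; in the second all faces at v belong to the
   region, which crosses no M-edge. *)
Lemma region_M_edge v a b m : dtail a = v -> dtail b = v -> dtail m = v -> a != b ->
  (forall d, dtail d = v -> bdry region d.1 = (d == a) || (d == b)) ->
  m.1 \in M -> bdry region m.1.
Proof.
move=> av bv mv ab vR mM; apply: contraT => /negPf mR.
have [m' [_ _ mU']] := (perfectP M).1 M_perfect v.
have mU d : dtail d = v -> d.1 \in M -> d = m.
  by move=> dv dM; rewrite (mU' _ dv dM) (mU' _ mv mM).
have [n [nv nN nU]] := (perfectP N).1 N_perfect v.
have notM d : dtail d = v -> bdry region d.1 -> d.1 \notin M.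
  by move=> dv dR; apply/negP=> /(mU d dv) e; rewrite -e dR in mR.
(* No face beside [m] is in the region: if [m] is a chord, its lower face is excluded because [m] is
   in [M], and the upper one because [m] is not on the boundary. *)
have mreg d g : d = m \/ d = drev m -> dface D d = Some g -> region g = false.
  move=> dm dg; have dm1 : d.1 = m.1 by case: dm => ->.
  case: (edge_cases G2 rt d.1) => [[g' g'c e]|[g' [d' [e d'g' d'O]]]]; last first.
    rewrite -dm1 -e (bdry_outer _ d'g' d'O) in mR.
    case/same_edge: e => dd; first by move: dg; rewrite -dd d'g' => -[<-].
    by move: d'O; rewrite dd drevK -dface_None dg.
  have g'M : pe g' \in M by rewrite -e dm1.
  have g'F : bdry region (pe g') = false by rewrite -e dm1.
  have Rg' : region g' = false by rewrite region_up // g'M.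
  have [d1 d1e [d1g d1u]] := rt_edge rt g'c.
  case: (same_edge (d := d) (d' := d1)) => [|dd|dd]; first by rewrite e d1e.
    by move: dg; rewrite dd d1g => -[<-].
  move: dg; rewrite dd d1u => -[<-]; exact: bdry_region_M g'F.
have special (x y : dart G) : dtail x = v -> dtail y = v -> x != y ->
    (forall d, dtail d = v -> bdry region d.1 = (d == x) || (d == y)) ->
    x.1 \notin Cout D -> False.
  move=> xv yv xy vR' xC.
  have xR : bdry region x.1 by rewrite vR' ?eqxx.
  have yR : bdry region y.1 by rewrite vR' ?eqxx ?orbT.
  have chordN d : dtail d = v -> bdry region d.1 -> d.1 \notin Cout D ->
      exists g, [/\ g != c, d.1 = pe g, region g = false, region (up g) & s (up g)] /\ d.1 \in N.
    move=> dv dR dC; have dM := notM d dv dR.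
    have [g gc e] : exists2 g, g != c & d.1 = pe g by apply: (rt_chord rt); rewrite inE.
    exists g; move: (dR); rewrite e bdry_region // => /andP[Rg Rug].
    have [chg [|dg]] := region_exit gc Rg Rug; first by rewrite -e (negPf dM).
    have sg : s g = false by rewrite ds_parity dg addbb.
    rewrite sg /= in chg; split; first by split=> //; exact: negbTE.
    by have := bdry_s d.1; rewrite (negPf dM) e (bdry_pe rt) // sg chg.
  have [g [[gc xg Rg Rug sug] xN]] := chordN x xv xR xC.
  have NU d : dtail d = v -> d.1 \in N -> d = x.
    by move=> dv dN; rewrite (nU _ dv dN) (nU _ xv xN).
  have yN : y.1 \notin N.
    by apply/negP=> /(NU y yv) e; rewrite e eqxx in xy.
  have yC : y.1 \in Cout D.
    by apply: contraT => /(chordN y yv yR)[? [_ yN']]; rewrite yN' in yN.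
  pose A f := region f && s f.
  have stA d : inside A d = inside region d && inside s d by rewrite /inside; case: (dface _ _).
  have := even_bdry A v; rewrite (@big_addb1 _ _ _ x) ?xv //.
    by rewrite xg (bdry_pe rt) // /A Rg Rug sug.
  move=> d /eqP dv dx; rewrite bdryE !stA.
  have [dy|dy] := eqVneq d y.
    have [f [d' [e d'f d'O]]] := outer_Cout yC.
    have sf : s f = false.
      by rewrite -(bdry_outer s d'f d'O) bdry_s e (negPf (notM y yv yR)) (negPf yN).
    suff : bdry A y.1 = false by rewrite dy bdryE !stA.
    by rewrite -e (bdry_outer _ d'f d'O) /A sf andbF.
  have dR : bdry region d.1 = false by rewrite vR' // (negPf dx) (negPf dy).
  have [dm|dm] := eqVneq d m.
    have r1 : inside region d = false.
      by rewrite /inside; case dg: dface => [g'|] //=; apply: mreg dg; left.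
    have r2 : inside region (drev d) = false.
      by rewrite /inside; case dg: dface => [g'|] //=; apply: mreg dg; right; rewrite dm.
    by rewrite r1 r2.
  have dN : d.1 \notin N by apply/negP=> /(NU d dv) e; rewrite e eqxx in dx.
  have dM : d.1 \notin M by apply/negP=> /(mU d dv) e; rewrite e eqxx in dm.
  have := bdry_s d.1; rewrite (negPf dM) (negPf dN) bdryE => /addb_false_eq->.
  by move: dR; rewrite bdryE => /addb_false_eq->; rewrite addbb.
have aC : a.1 \in Cout D by apply: contraT => /(special a b av bv ab vR).
have bC : b.1 \in Cout D.
  apply: contraT => bC; exfalso; apply: (special b a bv av _ _ bC); first by rewrite eq_sym.
  by move=> d /vR; rewrite orbC.
have [o oO ov] := outer_vertex D v.
(* The only outer edges at [v] are those of [o] and of its predecessor in the rotation. *)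
have Cv d : dtail d = v -> d.1 \in Cout D -> d = o \/ rotation D d = o.
  move=> dv; rewrite CoutE => /orP[]dO; [left|right]; apply: (outer_dtail_inj (D := D) G2) => //.
  - by rewrite dv ov.
  - by rewrite outerE face_rotation -outerE.
  - by rewrite dtail_rotation dv ov.
have Cab d : dtail d = v -> d.1 \in Cout D -> d = a \/ d = b.
  move=> dv dC; have rinj := @perm_inj _ (rotation D).
  case: (Cv d dv dC) => [->|dr]; case: (Cv a av aC) => [ao|ar].
  - by left.
  - case: (Cv b bv bC) => [bo|br]; first by right.
    by case/eqP: ab; apply: rinj; rewrite ar br.
  - case: (Cv b bv bC) => [bo|br]; first by rewrite ao bo eqxx in ab.
    by right; apply: rinj; rewrite dr br.
  - by left; apply: rinj; rewrite dr ar.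
(* Around [v], membership in the region enlarged by the outer face never changes, since the boundary
   edges [a] and [b] are exactly the outer edges there. *)
pose P d := (dtail d == v) ==> (inside region d || (d \in outer D)).
have out_st d : d \in outer D -> inside region d = false by rewrite -dface_None /inside => /eqP->.
have Prot d : P (rotation D d) = P d.
  rewrite /P dtail_rotation; have [dv|//] := eqVneq (dtail d) v; rewrite /=.
  rewrite /inside -dface_None /dface face_rotation -/(dface D (drev d)) -/(inside region (drev d))
    -/(dface D d) -/(inside region d) dface_None.
  have [dC|dC] := boolP (d.1 \in Cout D); last first.
    move: (dC); rewrite CoutE negb_or => /andP[/negPf-> /negPf->]; rewrite !orbF.
    apply/esym/addb_false_eq; rewrite -bdryE vR //.
    by apply/negP=> /orP[/eqP dd|/eqP dd]; move: dC; rewrite dd ?aC ?bC.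
  have dR : bdry region d.1 by rewrite vR //; case: (Cab d dv dC) => ->; rewrite eqxx ?orbT.
  move: dC dR; rewrite CoutE bdryE => /orP[]dO; rewrite dO (out_st _ dO) ?addbF /= => ->;
  by rewrite ?orbT.
have Po d : dtail d = v -> inside region d || (d \in outer D).
  move=> dv; have := vertex_cst (D := D) Prot (etrans dv (esym ov)).
  by rewrite /P dv ov eqxx /= oO orbT.
have mC : m.1 \notin Cout D.
  by apply/negP=> /(Cab m mv)[] e; move: mR; rewrite e vR // eqxx ?orbT.
have := Po m mv; rewrite /inside; move: mC; rewrite CoutE negb_or => /andP[/negPf-> _].
rewrite orbF; case mg: dface => [g|] //=.
by rewrite (mreg m g) //; left.
Qed.

(** Faces in the region keep their distance, already at most [k]; all others come closer by one. *)
Lemma region_flip : exists M', [/\ perfect_matching M',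
  exists2 C, alternating_cycle M C & M' = symdiff M C &
  exists s', [/\ forall e, bdry s' e = (e \in M') (+) (e \in N), s' c = odd k,
    forall f, dist up h s' f <= k &
    forall f, f != c -> pe f \in M' -> pe f \in N -> dist up h s' f = k]].
Proof.
have [d0 d0R] : exists d, bdry region d.1.
  case: (pickP (bdry region)) => [e eR|none]; first by exists (e, true).
  by have := region_root; rewrite (bdry_eq0 none).
have [b bc bR] : exists2 b, cycle_darts b & forall e, (e \in map (@dedge G) b) = bdry region e.
  apply: minimal_even_cycle d0R _; first exact: even_bdry.
  by move=> z ez zR; apply: up_closed_minimal; [exact: region_root|exact: region_up_closed|..].
have alt : alternating_darts M b.
  apply: alternatingP => // d; rewrite bR => dR.
  have [m [mv mM _]] := (perfectP M).1 M_perfect (dtail d).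
  exists m; split=> //; rewrite bR.
  have [[d1 [d2 [d1b d2b d1v d2v]]]|none] := cycle_at bc (dtail d); last first.
    by have := none d erefl; rewrite bR dR.
  apply: (region_M_edge (a := d2) (b := drev d1) _ _ mv) => //.
    exact: (cycle_turn bc).
  move=> d3 d3v; rewrite -bR (cycle_star bc d1b d2b) ?d1v //.
  by rewrite d3v.
pose C := [set e in map (@dedge G) b].
have inM' e : (e \in symdiff M C) = (e \in M) (+) bdry region e by rewrite in_symdiff inE bR.
exists (symdiff M C); split.
- exact: perfect_flip.
- by exists C => //; exists b.
pose s' f := s f (+) region f.
(* On the way to the root, [s] changes where the region is entered, and adding [region] cancels
   exactly this change. *)
have ds' f : dist up h s' f + ~~ region f = ds f.
  elim/(tree_ind h_up): f => [|f fc IH].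
    by rewrite /ds !(dist_root _ h_root) region_root.
  rewrite (dist_up h_up s' fc) [RHS](dist_up h_up s fc : ds f = _ + ds (up f)) -IH /s'.
  have := region_up_closed fc; have := @region_exit f fc.
  case: (region f) => [_ /(_ isT)->|]; first by rewrite addn0 addbACA addbb addbF addn0.
  case: (region (up f)) => [/(_ isT isT)[+ _] _|_ _]; last by rewrite addbACA addbb addbF addnA.
  by rewrite addbACA => -> /=; lia.
exists s'; split.
- by move=> e; rewrite bdry_addb bdry_s inM' addbAC.
- by rewrite /s' s_root region_root addbT /= negbK.
- move=> f; have := ds' f; have := ds_le f; have := @region_dist f.
  by case: (region f) => [/(_ isT)|_] /=; lia.
(* A chord shared with [N] either was already in [M], or is gained on the boundary of the region. In
   both cases its lower face was at distance [k.+1] and outside the region. *)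
move=> f fc; rewrite inM' => fM' fN; have := ds' f.
move: fM'; rewrite bdry_region //.
have [R|/= Rf] := boolP (region f).
  rewrite /= addbF => fM; have := region_dist R; rewrite (chord_MN fc fM fN); lia.
case Ru: (region (up f)).
  rewrite addbT => fM; have [_ [|->]] := region_exit fc Rf Ru; last by lia.
  by rewrite (negPf fM).
by rewrite addbF => fM; rewrite (chord_MN fc fM fN); lia.
Qed.

End Flip.

Lemma reconf_upper N k M s : perfect_matching M -> perfect_matching N ->
  (forall e, bdry s e = (e \in M) (+) (e \in N)) -> s c = odd k ->
  (forall f, dist up h s f <= k) ->
  (forall f, f != c -> pe f \in M -> pe f \in N -> dist up h s f = k) ->
  exists Ms, reconf_seq M N k Ms.
Proof.
move=> + PN; elim: k M s => [|k IH] M s PM bs sc sd MN.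
  have s0 f : s f = false.
    have := odd_dist h_root h_up s f; have := sd f; rewrite leqn0 => /eqP->.
    by rewrite sc addbF.
  have eMN : M = N.
    by apply/setP=> e; apply: addb_false_eq; rewrite -bs (eq_bdry s0) bdry0.
  by exists (fun _ => M); split.
have [M' [PM' [C altC M'E] [s' [bs' s'c s'd M'N]]]] := region_flip PM PN bs sc sd MN.
have [Ms [Ms0 Msk Msp Mss]] := IH M' s' PM' bs' s'c s'd M'N.
exists (fun i => if i is j.+1 then Ms j else M); split=> //.
  by case=> // i; exact: Msp.
by case=> [_|i]; [exists C; rewrite ?Ms0|exact: Mss].
Qed.

End Regions.

(** * The tree G* *)

Section GStar.
Variables (G : mgraph) (D : outerplane_drawing G).
Hypothesis G2 : two_connected G.
Implicit Types (d : dart G) (e : edge G) (f g : bface D) (u w : uface D).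
Implicit Types (M N : {set edge G}) (s F : bface D -> bool) (x y z : gstar D).

Definition ginside s x := if x is inl f then s f else false.

Lemma EfP e f : reflect (exists2 d, d.1 = e & dface D d = Some f) (e \in Ef f).
Proof.
apply: (iffP imsetP) => [[d /dfaceP df ->]|[d <- /dfaceP df]]; by exists d.
Qed.

Lemma Ef_Cout d f : dface D d = Some f -> d.1 \in Cout D -> drev d \in outer D.
Proof. by move=> df; rewrite CoutE -dface_None df. Qed.

Lemma outer_at_uface f : outer_at f -> exists u, val u = f.
Proof.
move=> /outer_atP[d df dO].
have fU : Ef f :&: Cout D != set0.
  apply/set0Pn; exists d.1; rewrite inE CoutE dO orbT andbT.
  by apply/EfP; exists d.
by exists (exist _ f fU).
Qed.

Lemma gstar_adj_inr_r x u : gstar_adj x (inr u) -> x = inl (val u).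
Proof. by case: x => //= f /eqP<-. Qed.

Lemma gstar_adj_inr_l x u : gstar_adj (inr u) x -> x = inl (val u).
Proof. by case: x => //= f /eqP<-. Qed.

Section RootedGStar.
Variables (c : bface D) (up : bface D -> bface D) (h : bface D -> nat).
Variable pe : bface D -> edge G.
Hypothesis rt : rooted c up h pe.

Definition gup x : gstar D := match x with inl f => inl (up f) | inr u => inl (val u) end.
Definition gh x := match x with inl f => h f | inr u => (h (val u)).+1 end.

Lemma gh_root : gh (inl c) = 0.
Proof. exact: rt_root rt. Qed.

Lemma gh_up x : x != inl c -> gh x = (gh (gup x)).+1.
Proof. by case: x => //= f fc; apply: (rt_up rt); apply: contra fc => /eqP->. Qed.

Lemma up_neq f : f != c -> up f != f.
Proof. by move=> fc; apply/eqP=> e; have := rt_up rt fc; rewrite e; lia. Qed.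

(** Any shared edge is a parent chord of one of the two faces, and the depths leave only [pe f]. *)
Lemma shared_edge f : f != c -> Ef f :&: Ef (up f) = [set pe f].
Proof.
move=> fc; apply/setP=> e; rewrite !inE.
have [d de [d1 d2]] := rt_edge rt fc.
apply/andP/eqP => [[/EfP[d' <- df] /EfP[d'' d''e d''u]]|->]; last first.
  by split; apply/EfP; [exists d|exists (drev d)].
case: (same_edge d''e) => dd.
  by move: d''u; rewrite dd df => -[] /esym/eqP; rewrite (negPf (up_neq fc)).
rewrite dd in d''u; have [[]//|[uc _ uf]] := chord_cases rt df d''u.
by have := rt_up rt fc; have := rt_up rt uc; rewrite -uf; lia.
Qed.

Lemma tree_adj_inl f g : tree_adj (inl c) gup (inl f) (inl g) =
  (f != c) && (up f == g) || (g != c) && (up g == f).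
Proof. by []. Qed.

Lemma tree_adj_inr x u : tree_adj (inl c) gup x (inr u) = (x == inl (val u)).
Proof.
have e : (gup x == inr u) = false by case: x.
by rewrite /tree_adj e andbF [RHS]eq_sym.
Qed.

Lemma gstar_adjE x y : gstar_adj x y = tree_adj (inl c) gup x y.
Proof.
have symT : tree_adj (inl c) gup y x = tree_adj (inl c) gup x y by rewrite /tree_adj orbC.
case: x y symT => [f|u] [g|w] symT; last 3 first.
- by rewrite tree_adj_inr [RHS]eq_sym.
- by rewrite -symT tree_adj_inr [RHS]eq_sym.
- by rewrite tree_adj_inr.
clear symT; rewrite tree_adj_inl -[LHS]/((f != g) && (#|Ef f :&: Ef g| == 1)).
apply/andP/orP => [[fg /cards1P[e eE]]|].
  have : e \in Ef f :&: Ef g by rewrite eE set11.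
  rewrite inE => /andP[/EfP[d <- df] /EfP[d' /same_edge[->|->]]].
    by rewrite df => -[e1]; rewrite e1 eqxx in fg.
  by case/(chord_cases rt df) => [[-> _ ->]|[-> _ ->]]; rewrite eqxx; [left|right].
case=> /andP[fc /eqP <-]; split.
- by rewrite eq_sym up_neq.
- by rewrite (shared_edge fc) cards1.
- exact: up_neq.
- by rewrite setIC (shared_edge fc) cards1.
Qed.

Lemma path_gstar_tree x p : path (@gstar_adj _ D) x p = path (tree_adj (inl c) gup) x p.
Proof. by apply: eq_path => y z; exact: gstar_adjE. Qed.

Lemma gstar_connected x y : exists p, gstar_path x y p.
Proof.
have sym : connect_sym (@gstar_adj _ D).
  by apply: sym_connect_sym => a b; rewrite !gstar_adjE /tree_adj orbC.
have rc a : connect (@gstar_adj _ D) (inl c) a.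
  elim/(tree_ind gh_up): a => [|a ac IH]; first exact: connect0.
  by apply: connect_trans IH (connect1 _); rewrite gstar_adjE /tree_adj ac eqxx orbT.
have /connectP[p xp ->] : connect (@gstar_adj _ D) x y.
  by apply: connect_trans (rc y); rewrite sym.
by case/shortenP: xp => q xq uq _; exists q; apply/and3P.
Qed.

Lemma anc_inl f g : anc up h f g -> anc gup gh (inl f) (inl g).
Proof.
elim/(tree_ind (rt_up rt)): g => [|g gc IH].
  by rewrite (anc_root _ (rt_root rt)) (anc_root _ gh_root).
rewrite (anc_up (rt_up rt)) // (anc_up gh_up) // => /orP[/eqP->|/IH]; first by rewrite eqxx.
by move=> /= ->; rewrite orbT.
Qed.

Lemma anc_inr x u : anc gup gh x (inr u) = (x == inr u) || anc gup gh x (inl (val u)).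
Proof. by rewrite (anc_up gh_up). Qed.

Lemma inr_anc u x : anc gup gh (inr u) x -> x = inr u.
Proof.
elim/(tree_ind gh_up): x => [|x xc IH]; first by rewrite (anc_root _ gh_root).
rewrite (anc_up gh_up) // => /orP[/eqP->//|/IH]; by case: x {xc IH}.
Qed.

Lemma dist_inl s f : dist gup gh (ginside s) (inl f) = dist up h s f.
Proof.
elim/(tree_ind (rt_up rt)): f => [|f fc IH].
  by rewrite (dist_root _ gh_root) (dist_root _ (rt_root rt)).
by rewrite (dist_up gh_up) // (dist_up (rt_up rt)) // -IH.
Qed.

Lemma dist_inr s u : dist gup gh (ginside s) (inr u) = s (val u) + dist up h s (val u).
Proof. by rewrite (dist_up gh_up) //= dist_inl. Qed.

Lemma gpath_apex s x p : path (@gstar_adj _ D) x p -> uniq (x :: p) ->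
  exists z, [/\ anc gup gh z x, anc gup gh z (last x p),
    changes (ginside s) x p + 2 * dist gup gh (ginside s) z =
      dist gup gh (ginside s) x + dist gup gh (ginside s) (last x p)
    & forall z', anc gup gh z' x -> anc gup gh z' (last x p) ->
        dist gup gh (ginside s) z' <= dist gup gh (ginside s) z].
Proof. rewrite path_gstar_tree; exact: (path_apex gh_root gh_up). Qed.

Section Lengths.
Variables (M N : {set edge G}) (s : bface D -> bool).
Hypothesis bdry_s : forall e, bdry s e = (e \in M) (+) (e \in N).
Hypothesis Ein_MN : Ein D :&: M :&: N = set0.

(** An outer edge of the face separates it from the outside, so membership in M (+) N is the same
    for all of them. *)
Lemma in_U1E u : in_U1 M N u = s (val u).
Proof.
have eu e : e \in Ef (val u) :&: Cout D -> (e \in symdiff M N) = s (val u).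
  rewrite inE => /andP[/EfP[d <- df] /(Ef_Cout df) dO].
  by rewrite in_symdiff -bdry_s (bdry_outer _ df dO).
have /set0Pn[e0 e0u] := valP u; apply/subsetP/idP => [/(_ _ e0u)|su e /eu->//].
by rewrite eu.
Qed.

(** Because no chord is in both matchings, the sum agrees with its parity. *)
Lemma ell_chord f : f != c -> (pe f \in M) + (pe f \in N) = s f (+) s (up f) :> nat.
Proof.
move=> fc; rewrite -(bdry_pe rt) // bdry_s.
have [d de [d1 d2]] := rt_edge rt fc.
have eE : pe f \in Ein D by apply/EinP; exists f, (up f), d.
have := in_set0 (pe f); rewrite -Ein_MN !in_setI eE /=.
by case: (_ \in M); case: (_ \in N).
Qed.

Lemma ellE x y : gstar_adj x y -> ell M N x y = ginside s x (+) ginside s y :> nat.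
Proof.
case: x y => [f|u] [g|w] //=; last 2 first.
- by move=> /eqP <-; rewrite in_U1E addbF.
- by move=> /eqP <-; rewrite in_U1E.
rewrite -[_ && _]/(gstar_adj (inl f) (inl g)) gstar_adjE tree_adj_inl.
case/orP=> /andP[fc /eqP <-]; first by rewrite shared_edge // big_set1 ell_chord.
by rewrite setIC shared_edge // big_set1 ell_chord // addbC.
Qed.

Lemma path_lengthE x p : path (@gstar_adj _ D) x p ->
  path_length M N x p = changes (ginside s) x p.
Proof.
elim: p x => //= y p IH x /andP[xy yp].
by rewrite changes_cons -(IH _ yp) -(ellE xy).
Qed.

End Lengths.

(* Rooting the tree at a face inside the cycle, a simple path enters and leaves
   the inside of the cycle at most once. *)
Lemma changes_region F b x p : cycle_darts b ->
  (forall e, (e \in map (@dedge G) b) = bdry F e) -> F c ->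
  path (@gstar_adj _ D) x p -> uniq (x :: p) -> changes (ginside F) x p <= 2.
Proof.
move=> bc bF Fc xp up_; have Fup := cycle_up_closed G2 rt bc bF Fc.
have le1 y : dist gup gh (ginside F) y <= 1.
  case: y => [f|u]; rewrite ?dist_inl ?dist_inr (up_closed_dist rt) //; first by case: (F f).
  by case: (F (val u)).
have [z [_ _ ch _]] := gpath_apex F xp up_.
have := le1 x; have := le1 (last x p); lia.
Qed.

End RootedGStar.

Lemma changes_addb s F x p :
  changes (ginside s) x p <= changes (ginside (fun f => s f (+) F f)) x p + changes (ginside F) x p.
Proof.
have gstD y : ginside (fun f => s f (+) F f) y = ginside s y (+) ginside F y by case: y.
elim: p x => //= y p IH x; rewrite !changes_cons !gstD addnACA leq_add //.
by do 4!case: (ginside _ _).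
Qed.

Lemma changes0 s x p : (forall f, s f = false) -> changes (ginside s) x p = 0.
Proof.
move=> s0; elim: p x => //= y p IH x; rewrite changes_cons IH.
by case: x y => [f|u] [g|w] /=; rewrite ?s0.
Qed.

(** Each reversal removes at most two changes. The tree is rooted anew at each step, at a face
    enclosed by the reversed cycle. *)
Lemma reconf_lower N t Ms M s x p : perfect_matching N -> reconf_seq M N t Ms ->
  (forall e, bdry s e = (e \in M) (+) (e \in N)) ->
  path (@gstar_adj _ D) x p -> uniq (x :: p) -> changes (ginside s) x p <= 2 * t.
Proof.
move=> PN; elim: t Ms M s => [|t IH] Ms M s [Ms0 Mst Msp Mss] bs xp up_.
  rewrite changes0 //; apply: (bdry_eq0 G2) => e.
  by rewrite bs -Ms0 Mst addbb.
have [C [b [bc _ ->]] M1] := Mss 0 isT.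
have [F bF] := even_is_bdry D G2 (even_cycle bc).
have {}bF e : (e \in map (@dedge G) b) = bdry F e by rewrite bF.
have [c Fc] : exists c, F c.
  case: (pickP F) => [c Fc|F0]; first by exists c.
  have /and4P[+ _ _ _] := bc; case: b bc bF {M1} => // d b _ /(_ d.1).
  by rewrite inE eqxx (eq_bdry F0) bdry0.
have [up [h [pe rt]]] := exists_rooted G2 c.
apply: leq_trans (changes_addb s F x p) _; rewrite mulnS addnC leq_add //.
  exact: (changes_region rt bc bF Fc xp up_).
apply: (IH (fun i => Ms i.+1) (Ms 1)) => //.
  by split=> // i it; [exact: Msp|exact: Mss].
by move=> e; rewrite bdry_addb bs M1 in_symdiff inE Ms0 bF addbAC.
Qed.

Lemma size_simple x p : uniq (x :: p) -> size p <= #|gstar D|.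
Proof. by move=> /card_uniqP /= e; apply: ltnW; rewrite -e; exact: max_card. Qed.

(** A path between copies with the most changes has both ends outside [s], hence an even number 2k
    of changes, and [c] is taken halfway. *)
Lemma exists_center s : (exists f, s f) -> 1 < #|bface D| ->
  exists k c up h pe, [/\ rooted c up h pe, s c = odd k,
    forall x, dist (gup up) (gh h) (ginside s) x <= k
    & exists x p, [/\ path (@gstar_adj _ D) x p, uniq (x :: p)
                    & changes (ginside s) x p = 2 * k]].
Proof.
move=> [f0 sf0] card2.
pose T := (uface D * uface D * #|gstar D|.-bseq (gstar D))%type.
pose isP (t : T) := gstar_path (inr t.1.1) (inr t.1.2) t.2.
pose len (t : T) := changes (ginside s) (inr t.1.1) t.2.
have mk u w p : gstar_path (inr u) (inr w) p ->
    exists2 t, isP t & [/\ t.1.1 = u, t.1.2 = w & t.2 = p :> seq _].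
  move=> up_; have /and3P[_ /size_simple sp _] := up_.
  by exists (u, w, Bseq sp).
(* Some path between copies has a change, so that [k] will be positive. *)
have [t0 t0P t0len] : exists2 t, isP t & 0 < len t.
  have [w wf] : exists w, val w != f0.
    have [up [h [pe rt]]] := exists_rooted G2 f0.
    have [g gf] : exists g, g != f0.
      move: card2; rewrite (cardD1 f0) inE add1n ltnS => /card_gt0P[g].
      by rewrite !inE andbT; exists g.
    have [u gu /outer_at_uface[w wu]] := outer_descendant G2 rt g.
    exists w; rewrite wu; apply: contra gf => /eqP uf.
    by move: gu; rewrite uf (anc_root _ (rt_root rt)).
  have [up [h [pe rt]]] := exists_rooted G2 (val w).
  have [u0 fu /outer_at_uface[u uu]] := outer_descendant G2 rt f0; rewrite -{}uu in fu.
  have [p up_] := gstar_connected rt (inr w) (inr u).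
  have [t tP [tw tu tp]] := mk _ _ _ up_; exists t => //.
  rewrite /len tw tp; have /and3P[wp uwp /eqP pl] := up_.
  have [z [zw zu ch _]] := gpath_apex rt s wp uwp; rewrite pl in zu ch.
  have z0 : dist (gup up) (gh h) (ginside s) z = 0.
    move: zw; rewrite (anc_inr rt) (anc_root _ (gh_root rt)) => /orP[]/eqP ze.
      move: zu; rewrite ze => /(inr_anc rt)[uw].
      by move: fu; rewrite uw (anc_root _ (rt_root rt)) eq_sym (negPf wf).
    by rewrite ze (dist_root _ (gh_root rt)).
  have odu := odd_dist (gh_root rt) (gh_up rt) (ginside s) (inr u).
  have odf := odd_dist (gh_root rt) (gh_up rt) (ginside s) (inl f0).
  have le : dist (gup up) (gh h) (ginside s) (inl f0) <= dist (gup up) (gh h) (ginside s) (inr u).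
    apply: (dist_anc (gh_root rt) (gh_up rt)).
    by rewrite (anc_inr rt) (anc_inl rt) ?orbT.
  (* By parity, the distance to [inr u] is odd if the root is in [s]; otherwise the distance to
     [f0], an ancestor of [inr u], is odd. *)
  have dpos : 0 < dist (gup up) (gh h) (ginside s) (inr u).
    move: odu odf; rewrite /= sf0; case: (s (val w)) => [/odd_gt0//|_ /odd_gt0].
    by move/leq_trans; apply.
  by move: ch; rewrite z0 muln0 addn0 => ->; rewrite addn_gt0 dpos orbT.
case: (arg_maxnP len t0P) => -[[u w] p] pP pmax.
have {}pmax a b q : gstar_path (inr a) (inr b) q ->
    changes (ginside s) (inr a) q <= changes (ginside s) (inr u) p.
  by move=> /mk[t tP [ta tb tq]]; have := pmax t tP; rewrite /len ta tq.
have {t0 t0P t0len} Lpos : 0 < changes (ginside s) (inr u) p.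
  apply: leq_trans t0len _; move: t0P; exact: pmax.
have /and3P[up_ uup /eqP pl] : gstar_path (inr u) (inr w) p by [].
pose k := (changes (ginside s) (inr u) p)./2.
have L2 : changes (ginside s) (inr u) p = 2 * k.
  by rewrite -[LHS]odd_double_half (odd_changes (ginside s)) pl mul2n.
have [p1 [p2 [pE ch1]]] : exists p1 p2, bseqval p = p1 ++ p2 /\ changes (ginside s) (inr u) p1 = k.
  by apply: changes_split; rewrite L2 mul2n -addnn leq_addr.
have ch2 : changes (ginside s) (last (inr u) p1) p2 = k.
  by move: L2; rewrite pE changes_cat ch1 mul2n -addnn => /addnI.
have kpos : 0 < k by move: Lpos; rewrite L2 muln_gt0.
(* The midpoint is not a copy: as [k] is positive, the path would continue on both sides of it, but
   a copy has only one neighbour. *)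
have [c cE] : exists c, last (inr u) p1 = inl c.
  case le: (last _ p1) => [c|v]; first by exists c.
  exfalso; move: up_ uup; rewrite {}pE.
  case/lastP: p1 ch1 ch2 le => [|q z] ch1 ch2; first by rewrite -ch1 in kpos.
  rewrite last_rcons in ch2 *; move=> zE; subst z.
  case: p2 ch2 => [|b p2] ch2; first by rewrite -ch2 in kpos.
  rewrite cat_path rcons_path last_rcons => /andP[/andP[_ qv] /andP[vb _]].
  rewrite -cat_cons -rcons_cons cat_uniq => /and3P[_ /hasPn/(_ b (mem_head _ _)) nb _].
  case/negP: nb; rewrite (gstar_adj_inr_l vb) -(gstar_adj_inr_r qv).
  by rewrite mem_rcons inE mem_last orbT.
have [up [h [pe rt]]] := exists_rooted G2 c.
set d := dist (gup up) (gh h) (ginside s).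
have root0 : d (inl c) = 0 by rewrite /d (dist_root _ (gh_root rt)).
move: (up_) (uup); rewrite pE -cat_cons cat_uniq cat_path cE.
move=> /andP[path1 path2] /and3P[u1 nh u2].
have d1 : d (inr u) = k.
  have [z [_ + ch _]] := gpath_apex rt s path1 u1.
  rewrite cE (anc_root _ (gh_root rt)) => /eqP zE; move: ch.
  by rewrite zE cE ch1 -/d root0 muln0 !addn0.
have u2' : uniq (inl c :: p2).
  rewrite /= u2 andbT; apply: contra nh => cp2; apply/hasP.
  by exists (inl c) => //=; rewrite -cE mem_last.
have d2 : d (inr w) = k.
  have [z [+ _ ch _]] := gpath_apex rt s path2 u2'.
  rewrite (anc_root _ (gh_root rt)) => /eqP zE; move: ch.
  move: pl; rewrite pE last_cat cE => ->.
  by rewrite zE -{1}cE ch2 -/d root0 muln0 addn0 add0n.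
(* The apex of the longest path is at distance 0 from [c], because both ends are at distance [k] and
   the path has 2k changes. *)
have [z0 [_ _ ch0 z0max]] := gpath_apex rt s up_ uup.
rewrite pl L2 -/d d1 d2 in ch0 z0max.
have dU v : d (inr v) <= k.
  (* By maximality, a copy [v] can exceed distance [k] only if its common ancestors with [u] and
     with [w] have positive distance. Both are ancestors of [v], so the higher one is common to [u]
     and [w] and has distance 0. *)
  have far a : a = u \/ a = w -> exists z, [/\ anc (gup up) (gh h) z (inr a),
      anc (gup up) (gh h) z (inr v) & d (inr v) <= k + 2 * d z].
    move=> auw; have da : d (inr a) = k by case: auw => ->.
    have [q qP] := gstar_connected rt (inr a) (inr v).
    have := pmax _ _ _ qP; move: qP => /and3P[qp uq /eqP ql].
    have [z [za zv ch _]] := gpath_apex rt s qp uq; rewrite ql -/d da in zv ch.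
    by rewrite L2 => le; exists z; split=> //; move: ch le; clear; lia.
  have [z1 [z1u z1v d1v]] := far u (or_introl erefl).
  have [z2 [z2w z2v d2v]] := far w (or_intror erefl).
  case/orP: (anc_total (gh_root rt) (gh_up rt) z1v z2v) => zz.
    have := z0max z1 z1u (anc_trans (gh_root rt) (gh_up rt) zz z2w); move: ch0 d1v; clear; lia.
  have := z0max z2 (anc_trans (gh_root rt) (gh_up rt) zz z1u) z2w; move: ch0 d2v; clear; lia.
exists k, c, up, h, pe; split=> //.
- by have := odd_changes (ginside s) (inr u) p1; rewrite ch1 cE /= => ->.
- case=> [f|v]; last exact: dU.
  (* Every face has a copy below it, at least as far from the root. *)
  have [u' fu /outer_at_uface[v vu]] := outer_descendant G2 rt f.
  apply: leq_trans (dU v); apply: (dist_anc (gh_root rt) (gh_up rt)).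
  by rewrite (anc_inr rt) vu (anc_inl rt fu) orbT.
- by exists (inr u), p.
Qed.

End GStar.

(** * The gap as a maximum of path lengths, and the equality with the optimum *)

Lemma gap_le G (D : outerplane_drawing G) M N n :
  (forall (x y : gstar D) p, gstar_path x y p -> path_length M N x p <= n) -> gap D M N <= n.
Proof.
move=> len; apply/bigmax_leqP => x _; apply/bigmax_leqP => y _.
by apply/bigmax_leqP => p; exact: len.
Qed.

Lemma gap_ge G (D : outerplane_drawing G) M N (x : gstar D) p :
  path (@gstar_adj G D) x p -> uniq (x :: p) -> path_length M N x p <= gap D M N.
Proof.
move=> xp up; have xyp : gstar_path x (last x p) (Bseq (size_simple up)) by apply/and3P.
have le3 : path_length M N x p <= gstar_dist M N x (last x p).
  exact: (leq_bigmax_cond (P := fun q : #|gstar D|.-bseq _ => gstar_path x _ q) _ xyp).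
apply: leq_trans le3 (leq_trans (leq_bigmax _) (leq_bigmax _)).
Qed.

(** If there are no chords and M <> N, a single reversal is optimal, but G* is one edge of length 1
    and half the gap is 1/2. The hypothesis [not_cycle] excludes this case. *)
Theorem theorem2 (G : mgraph) (D : outerplane_drawing G) (M N : {set edge G})
  (G_2connected : two_connected G)
  (M_perfect : perfect_matching M) (N_perfect : perfect_matching N)
  (not_cycle : ~ (Ein D = set0 /\ M <> N))
  (Ein_MN : Ein D :&: M :&: N = set0) :
  exists2 opt : nat, is_OPT M N opt & (opt%:R = (gap D M N)%:R / 2 :> rat)%R.
Proof.
suff [k opt ->] : exists2 k, is_OPT M N k & gap D M N = 2 * k.
  exists k => //; by rewrite GRing.natrM GRing.mulrAC GRing.divff // GRing.mul1r.
have [s bs] := even_is_bdry D G_2connected (even_symdiff M_perfect N_perfect).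
have [eMN|/eqP MN] := eqVneq M N.
  have s0 : forall f, s f = false.
    by apply: (bdry_eq0 G_2connected) => e; rewrite bs eMN addbb.
  exists 0.
    by split=> //; exists (fun=> M); split.
  apply/eqP; rewrite -leqn0; apply: gap_le => x y p /and3P[xp _ _].
  have [c _] : exists c : bface D, true.
    by case: x {xp} => [c|u]; [exists c|exists (val u)].
  have [up [h [pe rt]]] := exists_rooted G_2connected c.
  by rewrite (path_lengthE rt bs Ein_MN xp) changes0.
have [f sf] : exists f, s f.
  case: (pickP s) => [f sf|s0]; first by exists f.
  case: MN; apply/setP=> e; apply: addb_false_eq; by rewrite -bs (eq_bdry s0) bdry0.
(* As M <> N there is a chord, hence a second bounded face. *)
have card2 : 1 < #|bface D|.
  rewrite -(card_Ein D G_2connected) ltnS lt0n cards_eq0.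
  by apply/eqP=> E0; apply: not_cycle.
have [k [c [up [h [pe [rt sc dk [x [p [xp uxp ch]]]]]]]]] :=
  exists_center G_2connected (ex_intro _ f sf) card2.
exists k; last first.
  apply/eqP; rewrite eqn_leq; apply/andP; split.
    apply: gap_le => y z q /and3P[yq uq _].
    rewrite (path_lengthE rt bs Ein_MN yq).
    (* The length of a path is at most the sum of the distances of its ends from [c], each at most
       [k]. *)
    have [z' [_ _ chq _]] := gpath_apex rt s yq uq.
    by have := dk y; have := dk (last y q); lia.
  by rewrite -ch -(path_lengthE rt bs Ein_MN xp); exact: gap_ge.
split.
  apply: (reconf_upper G_2connected rt M_perfect N_perfect bs sc).
    by move=> g; rewrite -(dist_inl rt).
  move=> g gc gM gN; have := in_set0 (pe g); rewrite -Ein_MN !in_setI gM gN !andbT.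
  have [d de [d1 d2]] := rt_edge rt gc.
  by case/negP; apply/EinP; exists g, (up g), d.
move=> t Ms reconf.
by have := reconf_lower G_2connected N_perfect reconf bs xp uxp; rewrite ch; lia.
Qed.
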